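(* Let $G$ be a connected graph and let $k$, $\lambda$, $m$ be positive integers with $m\le\min\{k,\lambda\}+1$. If $$\sigma_m\ge t_{k+1}-\lambda(k-m+1),$$ then $t_k\ge t_{k+1}-\lambda+1$.
   Context: All graphs are finite, undirected, without loops or multiple edges. The order of a (sub)graph is its number of vertices. A leaf of a tree is a vertex of degree one in the tree. For a positive integer $k$, a $k$-ended tree is a tree with at most $k$ leaves. By convention, a 1-ended tree is interpreted as a cycle, where a single vertex and a single edge ($K_2$) are regarded as cycles of orders 1 and 2, respectively. For a graph $G$, $t_k$ denotes the order of a largest $k$-ended tree that is a (not necessarily induced) subgraph of $G$; in particular $t_1$ is the order of a longest cycle of $G$ (with vertices and edges counted as cycles of orders 1 and 2), and $t_2$ is the order of a longest path. Let $\alpha$ be the independence number of $G$. If $\alpha\ge m$, then $\sigma_m$ is the minimum, over all independent sets of $m$ vertices of $G$, of the sum of the degrees in $G$ of the vertices of the set; if $\alpha<m$, then $\sigma_m=+\infty$. *)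

(* Defs.v *)
From mathcomp Require Import all_boot all_order all_algebra.
From mathcomp Require Import boolp constructive_ereal.

Set Implicit Arguments.
Unset Strict Implicit.
Unset Printing Implicit Defensive.

(* A graph on T is a symmetric irreflexive relation e : rel T; a subgraph of it
   is a pair (V, r) of a vertex set and an adjacency relation, see [subgraph]. *)
Section Graphs.
Variable T : finType.
Implicit Types (e r : rel T) (V S : {set T}) (c : seq T) (k m : nat).

Definition degree r (x : T) : nat := #|[set y | r x y]|.

Definition connected_graph V r : Prop :=
  V != set0 /\ {in V &, forall x y, connect r x y}.

Definition subgraph V r e : Prop :=
  symmetric r /\ (forall x y, r x y -> [/\ x \in V, y \in V & e x y]).

(* By symmetry every edge xy gives a ucycle [:: x; y], which is not a cycle of
   the graph; hence the bound 2. *)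
Definition acyclic r : Prop := forall c, ucycle r c -> size c <= 2.

Definition tree V r : Prop := connected_graph V r /\ acyclic r.

Definition leaves V r : {set T} := [set x in V | degree r x == 1].

(* (V, r) is the cycle through the distinct vertices listed in c. Because of
   x != y, lists of size 1 and 2 give the degenerate cycles K_1 and K_2. *)
Definition cycle_graph V r : Prop :=
  exists c, [/\ c != [::], uniq c, V = [set x in c] &
    forall x y, r x y =
      [&& x \in c, y \in c, x != y & (y == next c x) || (x == next c y)]].

Definition ended_tree k V r : Prop :=
  if k == 1 then cycle_graph V r else tree V r /\ #|leaves V r| <= k.

(* t_k: the order of a largest k-ended tree of the graph e *)
Definition ended_tree_order e k : nat :=
  \max_(V : {set T} | `[< exists2 r, subgraph V r e & ended_tree k V r >]) #|V|.

Definition independent e S : bool :=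
  [forall x in S, forall y in S, ~~ e x y].

Definition independence_number e : nat :=
  \max_(S : {set T} | independent e S) #|S|.

(* sigma_m; in the first branch the minimum ranges over a nonempty family, so
   its neutral element +oo plays no role there. *)
Definition degree_sum e m : \bar int :=
  if m <= independence_number e then
    \big[Order.min/+oo%E]_(S : {set T} | independent e S && (#|S| == m))
      (Posz (\sum_(x in S) degree e x))%:E%E
  else +oo%E.

End Graphs.

(* Main.v *)
Require Import Defs.
From mathcomp Require Import all_boot all_order all_algebra.
From mathcomp Require Import boolp constructive_ereal.
From mathcomp Require Import zify.

(** Suppose that t_k + lambda <= t_(k+1) =: t, and let H be a (k+1)-ended tree
    of order t. Since t_k < t, it has exactly k+1 leaves, and by maximality a
    neighbour in G of a leaf of H lies on H. The proof bounds the degree sum of any m leaves of H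
    by t - 1 - lambda (k+1-m). As the leaves of H are pairwise nonadjacent, this
    contradicts the hypothesis on sigma_m.

    Surgery. What is known of H comes from one principle,
    [order_ge_spanning_ends]: a connected graph with c independent cycles and
    at most k - c vertices of degree at most one contains a spanning k-ended
    tree. So if vertices of H are deleted and edges of G are added, and the
    result is such a graph, then at least lambda vertices have been deleted.
    Adding an edge between two leaves would delete none, hence leaves are
    nonadjacent. Let u and v be joined by a path of H with inner vertices of
    degree two. If u and v are neighbours of two different leaves, then deleting
    the inner vertices and adding the two edges to the leaves leaves one cycle
    and k-1 ends, provided that the graph stays connected, so there are at least
    lambda inner vertices [leaf_nbrs_far]. The same holds if one of u and v is a
    neighbour of a leaf and the other one is a branching vertex
    [branch_above, branch_below].

    Charging. Choose a set S of m leaves and root H at one of them. A pair of a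
    leaf l in S and a neighbour v of l is charged to a vertex x, reached from v
    by a walk on H along vertices of degree two: towards l if l lies below v,
    and towards the root otherwise. Seen from x, the b leaves of S below x use
    the distances 1, ..., b, and the other leaves of S use 0, ..., m-b-1, each
    leaf its own distance. The walks do not run into branching vertices, because
    those are far away from v [charge_exists]. If two pairs were charged to the
    same vertex, then the two neighbours would have a distance of at most
    m-1 <= lambda, contrary to [leaf_nbrs_far]; so charging is injective
    [charge_inj]. It never hits the root, nor the last lambda vertices on the
    path of H that ends in a leaf outside S [charge_spare]. These are
    1 + lambda (k+1-m) vertices, which gives the bound [degree_count]. *)

Set Implicit Arguments.
Unset Strict Implicit.
Unset Printing Implicit Defensive.

(** * Spanning trees with few leaves *)

Section Graphs.
Variable T : finType.
Implicit Types (e r : rel T) (V A : {set T}) (F : {set T * T}) (x y z : T).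

Definition adj F x y := ((x, y) \in F) || ((y, x) \in F).

Lemma adj_sym F : symmetric (adj F).
Proof. by move=> x y; apply: orbC. Qed.

Definition del r x y a b :=
  r a b && ~~ (((a == x) && (b == y)) || ((a == y) && (b == x))).

Lemma del_sym r x y : symmetric r -> symmetric (del r x y).
Proof.
move=> rs a b; rewrite /del rs; congr (_ && ~~ _).
by rewrite orbC [(a == y) && _]andbC [(a == x) && _]andbC.
Qed.

(** The parent of a vertex is the next vertex on a shortest path to the root,
    and h is the distance to the root. *)
Lemma exists_parent r rho : exists p : T -> T, exists h : T -> nat,
  p rho = rho /\
  forall x, connect r x rho -> x != rho -> r x (p x) /\ h (p x) < h x.
Proof.
pose P n x := [exists q : n.-tuple T, path r x q && (last x q == rho)].
have exP x : connect r x rho -> exists n, P n x.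
  case/connectP=> q pq eq; exists (size q); apply/existsP; exists (in_tuple q).
  by rewrite pq -eq eqxx.
have /boolp.choice[h hP] : forall x, exists n, connect r x rho ->
    P n x /\ forall m, P m x -> n <= m.
  move=> x; case: (boolP (connect r x rho)) => [/exP cx|_]; last by exists 0.
  by exists (ex_minn cx); case: ex_minnP.
have /boolp.choice[p pP] : forall x, exists y,
    (x = rho -> y = rho) /\
    (connect r x rho -> x != rho -> r x y /\ h y < h x).
  move=> x; have [->|xrho] := eqVneq x rho; first by exists rho.
  case: (boolP (connect r x rho)) => [cx|_].
    2: by exists x; split=> [/eqP|//]; rewrite (negbTE xrho).
  have [] := hP x cx; case E: (h x) => [|n] /existsP[q /andP[]].
    by rewrite (tuple0 q) /= (negbTE xrho).
  case/tupleP: q => y q /= /andP[rxy pq] lq _; exists y.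
  split=> [/eqP|_ _]; first by rewrite (negbTE xrho).
  split=> //; have Py : P n y by apply/existsP; exists q; rewrite pq.
  have cy : connect r y rho.
    by apply/connectP; exists q => //; exact/esym/eqP.
  by rewrite ltnS; apply: (hP y cy).2.
exists p, h; split; first by apply: (pP rho).1.
by move=> x cx xr; apply: (pP x).2.
Qed.

(** Reaching a root along shortest paths assigns distinct edges to the vertices
    other than the root. *)
Lemma card_connected F V : V != set0 ->
  {in V &, forall x y, connect (adj F) x y} -> #|V| <= #|F| + 1.
Proof.
case/set0Pn=> rho rhoV con; have [p [h [_ pP]]] := exists_parent (adj F) rho.
pose f x := if (x, p x) \in F then (x, p x) else (p x, x).
have fF x : x \in V :\ rho -> f x \in F.
  case/setD1P=> xr xV; have [+ _] := pP x (con _ _ xV rhoV) xr.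
  by rewrite /f /adj; case: ifP.
have finj : {in V :\ rho &, injective f}.
  move=> x y /setD1P[xr xV] /setD1P[yr yV].
  have [_ hx] := pP x (con _ _ xV rhoV) xr.
  have [_ hy] := pP y (con _ _ yV rhoV) yr.
  rewrite /f; case: ifP => _; case: ifP => _ [] // exy eyx.
    by move: hx hy; rewrite eyx -exy => /ltn_trans lt /lt; rewrite ltnn.
  by move: hx hy; rewrite exy -eyx => /ltn_trans lt /lt; rewrite ltnn.
rewrite (cardsD1 rho) rhoV addnC leq_add2r -(card_in_imset finj).
by apply/subset_leq_card/subsetP=> _ /imsetP[x xV ->]; apply: fF.
Qed.

(** A path around the edge would close up to a cycle. *)
Lemma acyclic_bridge r x y : symmetric r -> irreflexive r -> acyclic r ->
  r x y -> ~~ connect (del r x y) x y.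
Proof.
move=> rs ri ac rxy; apply/negP=> /connectP[q0 pq0].
case/shortenP: pq0 => q pq uq _ ey.
have pr : path r x q by apply: sub_path pq => a b /andP[].
have : ucycle r (x :: q).
  by rewrite /ucycle uq andbT /= rcons_path pr -ey rs rxy.
move/ac; case: q pq {uq pr} ey => [|z [|? ?]] //= => [_|pq] ey.
  by rewrite ey ri in rxy.
by rewrite -ey /del !eqxx /= andbF in pq.
Qed.

(** The remainder of the cycle goes around the deleted edge. *)
Lemma del_cycle_connect r c x y : symmetric r -> ucycle r c -> 2 < size c ->
  x \in c -> y = next c x -> connect (del r x y) x y.
Proof.
move=> rs uc sc xc ->; rewrite (sym_connect_sym (del_sym _ _ rs)).
have [i d Ed] := rot_to xc.
rewrite -(next_rot i) ?(andP uc).2 // Ed.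
have : ucycle r (x :: d) by rewrite -Ed /ucycle rot_cycle rot_uniq; exact: uc.
have : 2 < size (x :: d) by rewrite -Ed size_rot.
case: d {Ed} => [|y' [|z d]] //= _; rewrite eqxx.
case/andP=> /= /and3P[rxy ryz]; rewrite rcons_path => /andP[pd rl].
case/andP; rewrite !inE !negb_or => /and3P[xy xz xd] /and3P[].
move=> /andP[yz yd] zd ud.
apply/connectP; exists (rcons (z :: d) x); last by rewrite last_rcons.
rewrite rcons_path; apply/andP; split.
  apply: (@sub_in_path _ (predC1 x) r) => [a b||] //=.
  - by rewrite !inE /del => ax bx ->; rewrite (negbTE ax) (negbTE bx) andbF.
  - rewrite ![_ == x]eq_sym xy xz /=; apply/allP=> a ad /=.
    by apply: contraNneq xd => <-.
  - by rewrite ryz.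
rewrite /del /= rl eqxx (negbTE xy) andbF andbT /=.
apply: contraNneq yd => E.
by have := mem_last z d; rewrite E inE (negbTE yz).
Qed.

Lemma del_connect r x y a b : symmetric r -> connect (del r x y) x y ->
  connect r a b -> connect (del r x y) a b.
Proof.
move=> rs cxy; apply: connect_sub => {}a {}b rab.
case: (boolP (del r x y a b)) => [/connect1 //|]; rewrite /del rab negbK.
case/orP=> /andP[/eqP-> /eqP->] //.
by rewrite (sym_connect_sym (del_sym _ _ rs)).
Qed.

(** Any other edge would be bypassed by the two parent paths from its ends to
    the root, and so it would not be a bridge. *)
Lemma acyclic_edge_parent r p h rho : symmetric r -> irreflexive r ->
    acyclic r ->
    (forall x, connect r x rho -> x != rho -> r x (p x) /\ h (p x) < h x) ->
  forall x y, connect r x rho -> r x y ->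
    (x != rho /\ p x = y) \/ (y != rho /\ p y = x).
Proof.
move=> rs ri ac pP x y cx rxy; apply: contrapT => npar.
have cdel : forall z, connect r z rho -> connect (del r x y) z rho.
  move=> z; have [n] := ubnP (h z); elim: n z => // n IH z lt cz.
  have [-> //|zr] := eqVneq z rho; have [rz hz] := pP z cz zr.
  apply: (@connect_trans _ _ (p z)); last first.
    apply: IH; first exact: leq_trans hz lt.
    by apply: connect_trans cz; apply: connect1; rewrite rs.
  apply: connect1; rewrite /del rz /=; apply/negP.
  by case/orP=> /andP[/eqP zx /eqP pz]; apply: npar; subst z; [left|right].
have cy : connect r y rho by apply: connect_trans cx; apply: connect1; rewrite rs.
have := acyclic_bridge rs ri ac rxy; case/negP.
apply: connect_trans (cdel x cx) _.
by rewrite (sym_connect_sym (del_sym _ _ rs)); apply: cdel.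
Qed.

(** At a vertex of largest height, all neighbours but the parent would be
    higher. *)
Lemma acyclic_leaf r V rho : symmetric r -> irreflexive r -> acyclic r ->
    {in V &, forall x y, connect r x y} ->
    (forall x y, r x y -> y \in V) -> rho \in V -> 1 < #|V| ->
  exists2 x, x \in leaves V r & x != rho.
Proof.
move=> rs ri ac con sub rV; rewrite (cardsD1 rho) rV => /card_gt0P[x0 x0V].
have [p [h [_ pP]]] := exists_parent r rho.
case: (@arg_maxnP _ x0 (mem (V :\ rho)) h x0V) => x /setD1P[xr xV] hmax.
exists x => //; rewrite inE xV /=; have [rx _] := pP x (con _ _ xV rV) xr.
rewrite /degree -(cards1 (p x)); apply/eqP; congr #|pred_of_set _|.
apply/setP=> y; rewrite !inE; apply/idP/eqP=> [rxy|-> //].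
have [[_ ->] //|[yr py]] :=
  acyclic_edge_parent rs ri ac pP (con _ _ xV rV) rxy.
have yV := sub _ _ rxy; have := hmax y; rewrite !inE yr => /(_ yV).
by have [_] := pP y (con _ _ yV rV) yr; rewrite py ltnNge => /negP nle /nle.
Qed.

Lemma next_neq_prev (c : seq T) x :
  uniq c -> 2 < size c -> x \in c -> next c x != prev c x.
Proof.
move=> uc sc xc; have [i d Ed] := rot_to xc.
rewrite -(next_rot i) // -(prev_rot i) //.
have : uniq (rot i c) by rewrite rot_uniq.
have : 2 < size (rot i c) by rewrite size_rot.
rewrite {}Ed prev_nth mem_head.
case: d => [|y [|z d]] //= _; rewrite eqxx => /andP[xd /and3P[yd _ _]].
have := xd; rewrite !inE !negb_or => /and3P[xy xz xd'].
rewrite ![_ == x]eq_sym (negbTE xy) (negbTE xz) (memNindex xd').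
rewrite -[_.+2]/(size [:: x, y, z & d]).-1 nth_last /=.
by apply: contraNneq yd => ->; apply: mem_last.
Qed.

Lemma degree2_cycle r (c : seq T) x y : symmetric r -> ucycle r c ->
    2 < size c -> x \in c -> degree r x <= 2 -> r x y ->
  (y == next c x) || (y == prev c x).
Proof.
move=> rs /andP[cc uc] sc xc deg rxy.
have neq := next_neq_prev uc sc xc.
have sub : [set next c x; prev c x] \subset [set y | r x y].
  apply/subsetP=> z; rewrite !inE => /orP[]/eqP->; first exact: next_cycle.
  by rewrite rs; apply: prev_cycle.
have /eqP E : [set next c x; prev c x] == [set y | r x y].
  by rewrite eqEcard sub cards2 neq.
have : y \in [set y | r x y] by rewrite inE.
by rewrite -E !inE.
Qed.

(** The two cycle edges at a vertex of the cycle are all its edges, so no edge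
    leaves the cycle. *)
Lemma degree2_cycle_spans r V (c : seq T) x : symmetric r -> ucycle r c ->
    2 < size c -> {in c, forall x, degree r x <= 2} ->
    {in V &, forall x y, connect r x y} -> x \in c -> x \in V ->
  {subset V <= c}.
Proof.
move=> rs uc sc deg con xc xV y yV.
have cl : closed r [pred z in c].
  apply: (intro_closed (sym_connect_sym rs)) => a b rab; rewrite !inE => ac.
  have := degree2_cycle rs uc sc ac (deg a ac) rab.
  by case/orP=> /eqP->; rewrite ?mem_next ?mem_prev.
by have := closed_connect cl (con _ _ xV yV); rewrite !inE xc.
Qed.

Lemma order_ge_ended_tree e k V r :
  subgraph V r e -> ended_tree k V r -> #|V| <= ended_tree_order e k.
Proof.
move=> sub et; rewrite /ended_tree_order.
apply: (@leq_bigmax_cond _ _ (fun V : {set T} => #|V|)).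
by apply/asboolP; exists r.
Qed.

Lemma degree_gt1 r x y z : y != z -> r x y -> r x z -> 1 < degree r x.
Proof.
by move=> yz ry rz; apply/card_gt1P; exists y, z; rewrite !inE.
Qed.

(** Edges are listed as pairs in an arbitrary orientation, so F has at least as
    many elements as the graph has edges. Likewise A contains the vertices of
    degree at most one, and possibly others: both counts are upper bounds, and
    adding a redundant edge or a redundant end to the lists is harmless. *)
Definition spanning_ends e V F A : Prop :=
 [/\ forall x y, (x, y) \in F -> [/\ x \in V, y \in V & e x y],
     {in V &, forall x y, connect (adj F) x y} &
     forall x, x \in V -> x \notin A ->
       exists y z, [/\ y != z, adj F x y & adj F x z]].

Lemma ended_tree_order_gt0 e k x : 0 < k -> 0 < ended_tree_order e k.
Proof.
move=> k0; rewrite -(cards1 x).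
pose r : rel T := fun _ _ => false.
apply: (@order_ge_ended_tree _ _ _ r); first by split=> [a b|a b].
rewrite /ended_tree; case: ifP => [_|_].
  exists [:: x]; split=> //; first by apply/setP=> y; rewrite !inE.
  move=> a b; rewrite /r !inE; symmetry; apply/negP.
  by case/and4P=> /eqP-> /eqP->; rewrite eqxx.
split; first split; first split.
- by apply/set0Pn; exists x; rewrite inE.
- by move=> a b /set1P-> /set1P->.
- by move=> [|a [|b c]] //; rewrite /ucycle /= /r.
- rewrite (_ : leaves _ _ = set0) ?cards0 //; apply/setP=> y; rewrite !inE.
  rewrite /degree (_ : [set _ | _] = set0) ?cards0 ?andbF //.
Qed.

Lemma ended_tree_order1_edge e x y : symmetric e -> irreflexive e -> e x y ->
  2 <= ended_tree_order e 1.
Proof.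
move=> es ei exy; have xy : x != y by apply: contraTneq exy => ->; rewrite ei.
have <- : #|[set x; y]| = 2 by rewrite cards2 xy.
pose r := [rel a b | [&& a \in [:: x; y], b \in [:: x; y] & a != b]].
apply: (@order_ge_ended_tree _ _ _ r).
  split=> a b; first by rewrite /= andbCA eq_sym.
  rewrite /= !inE => /and3P[/orP[]/eqP-> /orP[]/eqP->]; rewrite ?eqxx ?orbT //.
  by rewrite es.
exists [:: x; y]; split=> //; first by rewrite /= inE xy.
  by apply/setP=> z; rewrite !inE.
move=> a b; rewrite /r /=; case: (boolP (a \in _)) => //= ain.
case: (boolP (b \in _)) => //= bin; case: eqVneq => //= ab; symmetry.
move: ain bin ab; rewrite !inE.
have yx : (y == x) = false by rewrite eq_sym (negbTE xy).
by case/orP=> /eqP-> /orP[]/eqP->; rewrite ?eqxx ?(negbTE xy) ?yx ?eqxx.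
Qed.

Lemma leaves_subset r V F A : (forall x, x \in V -> x \notin A ->
       exists y z, [/\ y != z, adj F x y & adj F x z]) ->
  leaves V (adj F) \subset A.
Proof.
move=> two; apply/subsetP=> x; rewrite inE => /andP[xV /eqP deg].
apply: contraPT deg => xA; have [y [z [yz xy xz]]] := two x xV xA.
by have := degree_gt1 yz xy xz; case: degree => [|[]].
Qed.

Lemma adj_del F x y :
  adj (F :\: [set (x, y); (y, x)]) =2 del (adj F) x y.
Proof.
move=> a b; rewrite /adj /del !inE !xpair_eqE.
by case: (a == x) (a == y) (b == x) (b == y) (_ \in F) (_ \in F)
  => [] [] [] [] [] [].
Qed.

(** A connected graph has at least #|V| - 1 edges, so at most k ends remain. If
    k = 1, a tree with at most one leaf is a single vertex, a cycle of order 1. *)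
Lemma order_ge_acyclic e k V F A : symmetric e -> irreflexive e ->
    0 < k -> V != set0 -> spanning_ends e V F A -> acyclic (adj F) ->
  #|A| + #|F| + 1 <= #|V| + k -> #|V| <= ended_tree_order e k.
Proof.
move=> es ei k0 V0 [wf con two] ac le.
have rs := adj_sym F.
have sub : subgraph V (adj F) e.
  by split=> // a b /orP[]/wf[? ? ?]; split=> //; rewrite es.
have ri : irreflexive (adj F).
  by move=> a; apply/negP=> /sub.2[_ _]; rewrite ei.
have leA : #|A| <= k by have := card_connected V0 con; lia.
have leL := leq_trans (subset_leq_card (leaves_subset (fun _ _ => false) two)) leA.
have [k1|k1] := eqVneq k 1; last first.
  by apply: (order_ge_ended_tree sub); rewrite /ended_tree (negbTE k1).
have [x xV] := set0Pn _ V0.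
have [lt|/leq_trans->//] := ltnP 1 #|V|; last exact: ended_tree_order_gt0.
have subV a b : adj F a b -> b \in V by case/sub.2.
have [y yl _] := acyclic_leaf rs ri ac con subV xV lt.
have yV : y \in V by move: yl; rewrite inE => /andP[].
have [z zl zy] := acyclic_leaf rs ri ac con subV yV lt.
suff : 1 < #|leaves V (adj F)| by move: leL; rewrite k1 leqNgt => /negbTE->.
by apply/card_gt1P; exists z, y.
Qed.

(** The graph is the cycle itself; if k > 1, deleting one edge of it leaves a
    path. *)
Lemma order_ge_cycle e k V F c : symmetric e -> irreflexive e ->
    0 < k -> (forall x y, adj F x y -> [/\ x \in V, y \in V & e x y]) ->
    {in V &, forall x y, connect (adj F) x y} ->
    ucycle (adj F) c -> 2 < size c -> {in c, forall x, degree (adj F) x <= 2} ->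
  #|V| <= ended_tree_order e k.
Proof.
move=> es ei k0 sub con uc sc deg; have rs := adj_sym F.
have [cc unc] := andP uc.
have cV x : x \in c -> x \in V by move=> xc; case: (sub _ _ (next_cycle cc xc)).
have [x xc] : exists x, x \in c by case: c sc {uc deg cc unc cV} => // x c _; exists x; rewrite mem_head.
have Vc := degree2_cycle_spans rs uc sc deg con xc (cV x xc).
have VE : V = [set z in c].
  by apply/setP=> z; rewrite inE; apply/idP/idP=> [/Vc|/cV].
have rE a b : adj F a b =
    [&& a \in c, b \in c, a != b & (b == next c a) || (a == next c b)].
  apply/idP/idP=> [rab|/and4P[ac bc ab]]; last first.
    by case/orP=> /eqP->; rewrite ?next_cycle // rs next_cycle.
  have [/Vc ac /Vc bc eab] := sub _ _ rab; rewrite ac bc.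
  rewrite (contraTneq _ eab) => [|->]; last by rewrite ei.
  have /orP[->//|/eqP->] := degree2_cycle rs uc sc ac (deg a ac) rab.
  by rewrite next_prev // eqxx orbT.
have [k1|k1] := eqVneq k 1.
  apply: (@order_ge_ended_tree _ _ _ (adj F)); first by split.
  by rewrite /ended_tree k1; exists c; split=> //; apply: contraTneq xc => ->.
pose y := next c x; pose r := del (adj F) x y.
have rr : symmetric r by apply: del_sym.
have cxy := del_cycle_connect rs uc sc xc (erefl y).
have rcon : {in V &, forall a b, connect r a b}.
  by move=> a b aV bV; apply: del_connect rs cxy (con a b aV bV).
have rsub a b : r a b -> adj F a b by case/andP.
have neq := next_neq_prev unc sc xc.
have rx z : r x z -> z = prev c x.
  case/andP=> /(degree2_cycle rs uc sc xc (deg x xc)) /orP[]/eqP-> //.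
  by rewrite !eqxx.
apply: (@order_ge_ended_tree _ _ _ r).
  by split=> // a b /rsub /sub.
rewrite /ended_tree (negbTE k1); split; first split; first split=> //.
- by apply/set0Pn; exists x; apply: cV.
- (* A cycle of r is again the whole graph, but the vertex x has only one
     neighbour left. *)
  move=> d ud; rewrite leqNgt; apply/negP=> sd.
  have degd : {in d, forall z, degree r z <= 2}.
    move=> z zd; have zc : z \in c.
      have [cd _] := andP ud; apply: Vc.
      by have /rsub/sub[] := next_cycle cd zd.
    apply: leq_trans (deg z zc); apply/subset_leq_card/subsetP=> b.
    by rewrite !inE => /rsub.
  have [z zd] : exists z, z \in d by case: d sd {ud degd} => // z d _; exists z; rewrite mem_head.
  have zV : z \in V.
    by have [cd _] := andP ud; have /rsub/sub[] := next_cycle cd zd.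
  have xd := degree2_cycle_spans rr ud sd degd rcon zd zV (cV x xc).
  have [cd und] := andP ud; have := next_neq_prev und sd xd.
  rewrite (rx _ (next_cycle cd xd)) (rx (prev d x)) ?eqxx //.
  by rewrite rr prev_cycle.
- apply: (@leq_trans #|[set x; y]|); last first.
    by rewrite cards2; case: (x != y); case: (k) k0 k1 => [|[]].
  apply/subset_leq_card/subsetP=> z; rewrite !inE => /andP[zV dz].
  apply: contraLR dz; rewrite negb_or => /andP[zx zy].
  have zc := Vc _ zV; have neqz := next_neq_prev unc sc zc.
  have rz b : adj F z b -> r z b.
    by move=> zb; rewrite /r /del zb (negbTE zx) (negbTE zy).
  have := @degree_gt1 r z _ _ neqz (rz _ (next_cycle cc zc)).
  rewrite rz; last by rewrite rs prev_cycle.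
  by move=> /(_ isT); case: degree => [|[]].
Qed.

(** The bound on #|A| + #|F| says that the number of ends plus the number of
    independent cycles is at most k. Deleting an edge of a cycle at a vertex of
    degree at least three creates at most one new end, the other vertex of the
    edge, so the sum does not grow. If a cycle has no such vertex, then it is
    the whole graph. *)
Lemma order_ge_spanning_ends e k V F A : symmetric e -> irreflexive e ->
    0 < k -> V != set0 -> spanning_ends e V F A ->
  #|A| + #|F| + 1 <= #|V| + k -> #|V| <= ended_tree_order e k.
Proof.
move=> es ei k0 V0; have [n] := ubnP #|F|.
elim: n => // n IH in F A *; rewrite ltnS => leF sp le.
have [ac|] := EM (acyclic (adj F)); first exact: order_ge_acyclic sp ac le.
case/boolp.existsNP=> c /boolp.not_implyP[uc /negP]; rewrite -ltnNge => sc.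
have [wf con two] := sp; have rs := adj_sym F.
have sub x y : adj F x y -> [/\ x \in V, y \in V & e x y].
  by case/orP=> /wf[? ? ?]; split=> //; rewrite es.
have [/allP deg|/allPn[x xc]] := boolP (all (fun x => degree (adj F) x <= 2) c).
  exact: order_ge_cycle uc sc deg.
rewrite -ltnNge => deg; pose y := next c x.
have [cc unc] := andP uc; have rxy : adj F x y := next_cycle cc xc.
have [xV yV exy] := sub _ _ rxy.
have xy : x != y by apply: contraTneq exy => <-; rewrite ei.
have cxy := del_cycle_connect rs uc sc xc (erefl y).
pose F' := F :\: [set (x, y); (y, x)].
have ltF : #|F'| < #|F|.
  apply/proper_card/properP; split; first exact: subsetDl.
  by case/orP: rxy => xyF; [exists (x, y)|exists (y, x)]; rewrite // !inE !eqxx ?orbT.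
apply: (IH F' (y |: A)); first exact: leq_trans ltF leF.
  split.
  - by move=> a b /setDP[/wf].
  - move=> a b aV bV; rewrite (eq_connect (adj_del F x y)).
    exact: del_connect rs cxy (con a b aV bV).
  - move=> z zV; rewrite !inE negb_or => /andP[zy zA].
    have [zx|zx] := eqVneq z x; last first.
      have [a [b [ab za zb]]] := two z zV zA; exists a, b.
      by rewrite !adj_del /del za zb (negbTE zx) (negbTE zy).
    move: deg; rewrite /degree (cardsD1 y) inE rxy => /card_gt1P[a [b []]].
    rewrite !inE => /andP[ay xa] /andP[b_y xb] ab; exists a, b.
    rewrite zx !adj_del /del xa xb ab (negbTE ay) (negbTE b_y) (negbTE xy).
    by rewrite !andbF.
have : #|y |: A| <= #|A|.+1 by rewrite cardsU1; case: (_ \notin _).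
by move: ltF le; lia.
Qed.

End Graphs.

(** * Rooted trees and threads *)

Section RootedTree.
Variables (T : finType) (V : {set T}) (rho : T) (p : T -> T) (h : T -> nat).
Implicit Types (x y z v : T).
Hypothesis rhoV : rho \in V.
Hypothesis p_rho : p rho = rho.
Hypothesis pV : forall x, x \in V -> p x \in V.
Hypothesis hp : forall x, x \in V -> x != rho -> h (p x) < h x.

Definition kids x := [set y in V | (y != rho) && (p y == x)].
Definition single x := (x != rho) && (#|kids x| == 1).
(** The vertex v and the parent of iter n p v may branch: a thread is the inside
    of an unbranched path, together with the lower end of that path. *)
Definition thread v n := forall i, 0 < i <= n -> single (iter i p v).

Notation desc := (fconnect p).

Lemma mem_kids x y : (y \in kids x) = [&& y \in V, y != rho & p y == x].
Proof. by rewrite inE. Qed.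

Lemma iter_mem i x : x \in V -> iter i p x \in V.
Proof. by move=> xV; elim: i => //= i; apply: pV. Qed.

Lemma iter_root i : iter i p rho = rho.
Proof. by elim: i => //= i ->. Qed.

Lemma iter_root_le i j x : i <= j -> iter i p x = rho -> iter j p x = rho.
Proof. by move=> /subnK <- E; rewrite iterD E iter_root. Qed.

Lemma height_iter i x : x \in V -> x != rho -> 0 < i -> h (iter i p x) < h x.
Proof.
move=> xV xr; elim: i => //= -[_ _|i IH _]; first exact: hp.
have [E|ne] := eqVneq (iter i.+1 p x) rho; last first.
  exact: ltn_trans (hp (iter_mem _ xV) ne) (IH _).
by move: (IH isT); rewrite E p_rho.
Qed.

Lemma iter_neq i j x : x \in V -> i < j -> iter i p x != rho ->
  iter j p x != iter i p x.
Proof.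
move=> xV lt ne; rewrite -(subnK lt) addnS -addSn iterD.
have := height_iter (iter_mem i xV) ne (ltn0Sn (j - i.+1)).
by apply: contraTneq => ->; rewrite ltnn.
Qed.

Lemma desc_root_eq x : desc rho x -> x = rho.
Proof. by move/iter_findex <-; rewrite iter_root. Qed.

Lemma desc_p x y : desc (p x) y -> desc x y.
Proof. exact: connect_trans (fconnect1 p x). Qed.

Lemma desc_anti x y : x \in V -> desc x y -> desc y x -> x = y.
Proof.
move=> xV /iter_findex; set i := findex _ _ _; case: i => [//|i] E.
move=> /iter_findex; set j := findex _ _ _ => E'.
have [xr|xr] := eqVneq x rho; first by rewrite -E xr iter_root.
have := height_iter xV xr (ltn0Sn (j + i)).
by rewrite -addnS iterD E E' ltnn.
Qed.

Lemma desc_kid x y : y \in V -> desc y x -> y != x ->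
  exists2 z, z \in kids x & desc y z.
Proof.
move=> yV /iter_findex; move: (findex _ _ _) => i.
elim: i y yV => [y _ /= -> /eqP//|i IH y yV]; rewrite iterSr => E yx.
have yr : y != rho by apply: contraNneq yx => yr; rewrite -E yr -iterSr iter_root.
have [pyx|pyx] := eqVneq (p y) x.
  by exists y; rewrite ?connect0 // mem_kids yV yr pyx eqxx.
by have [z zx yz] := IH (p y) (pV yV) E pyx; exists z => //; apply: desc_p.
Qed.

Lemma iter_kid v n : v \in V -> iter n.+1 p v != rho ->
  iter n p v \in kids (iter n.+1 p v).
Proof.
move=> vV ne; rewrite mem_kids iter_mem // eqxx andbT /=.
by apply: contraNneq ne => E; rewrite /= E p_rho.
Qed.

Lemma single_kid z x y : single z -> x \in kids z -> y \in kids z -> x = y.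
Proof.
by case/andP=> _ /cards1P[w ->]; rewrite !inE => /eqP-> /eqP->.
Qed.

Lemma threadS v n : thread v n.+1 -> thread v n.
Proof. by move=> th i /andP[i0 le]; apply: th; rewrite i0 leqW. Qed.

Lemma thread_le v m n : m <= n -> thread v n -> thread v m.
Proof. by move=> le th i /andP[i0 im]; apply: th; rewrite i0 (leq_trans im). Qed.

Lemma thread_iter v i n : thread v (i + n) -> thread (iter i p v) n.
Proof.
move=> th j /andP[j0 jn]; rewrite -iterD; apply: th.
by rewrite addn_gt0 j0 addnC leq_add2l.
Qed.

Lemma thread_add v n : thread v n -> single (iter n.+1 p v) -> thread v n.+1.
Proof.
move=> th s i /andP[i0]; rewrite leq_eqVlt => /orP[/eqP->//|lt].
by apply: th; rewrite i0.
Qed.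

Lemma thread_cons x v n : p x = v -> single v -> thread v n -> thread x n.+1.
Proof.
move=> <- s th [//|i] /= ile; rewrite -/(iter i.+1 p x) iterSr.
by case: i ile => [//|i] ile; apply: th.
Qed.

(** A path that goes up to the end of a thread cannot enter the thread from
    aside. *)
Lemma thread_desc v n y : v \in V -> thread v n -> y \in V ->
    desc y (iter n p v) ->
  desc y v \/ exists2 i, 0 < i <= n & y = iter i p v.
Proof.
move=> vV + yV; elim: n => [|n IH] th d; first by left.
have [E|ne] := eqVneq y (iter n.+1 p v); first by right; exists n.+1; rewrite ?ltnSn.
have [z zk yz] := desc_kid yV d ne.
have s : single (iter n.+1 p v) by apply: th; rewrite ltnSn.
have E := single_kid s zk (iter_kid vV (andP s).1); subst z.
have [|[i /andP[i0 le] Ei]] := IH (threadS th) yz; first by left.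
by right; exists i => //; rewrite i0 leqW.
Qed.

(** The way down along a thread is unique. *)
Lemma thread_inj n x y : x \in V -> y \in V -> thread x n -> thread y n ->
  iter n p x = iter n p y -> x = y.
Proof.
move=> xV yV; elim: n => [//|n IH] thx thy E.
have sx : single (iter n.+1 p x) by apply: thx; rewrite ltnSn.
have kx := iter_kid xV (andP sx).1.
have sy : single (iter n.+1 p y) by apply: thy; rewrite ltnSn.
have ky := iter_kid yV (andP sy).1; rewrite -E in ky.
exact: IH (threadS thx) (threadS thy) (single_kid sx kx ky).
Qed.

Hypothesis kids_rho : #|kids rho| = 1.

Lemma thread_root v n y : v \in V -> thread v n -> iter n p v != rho ->
  iter n.+1 p v = rho -> y \in V -> y = rho \/ desc y (iter n p v).
Proof.
move=> vV th ne E yV; have [->|yr] := eqVneq y rho; [by left|right].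
have dr : desc y rho.
  have [m] := ubnP (h y); elim: m y yV {yr} => // m IH y yV lt.
  have [->|yr] := eqVneq y rho; first exact: connect0.
  by apply/desc_p/IH; [exact: pV|exact: leq_trans (hp yV yr) lt].
have [z zk yz] := desc_kid yV dr yr.
suff <- : z = iter n p v by [].
have k : iter n p v \in kids rho by rewrite mem_kids iter_mem // ne -[p _]/(iter n.+1 p v) E eqxx.
by move/eqP/cards1P: kids_rho zk k => [w ->]; rewrite !inE => /eqP-> /eqP->.
Qed.

(** Since the root has only one child, the tree is a path. *)
Lemma card_thread_root v n : v \in V -> thread v n -> iter n p v != rho ->
    iter n.+1 p v = rho -> (forall y, y \in V -> desc y v -> y = v) ->
  #|V| <= n.+2.
Proof.
move=> vV th ne E low.
have sub : V \subset [set iter (val i) p v | i : 'I_n.+2].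
  apply/subsetP=> y yV; apply/imsetP.
  have [->|] := thread_root vV th ne E yV; first by exists ord_max; rewrite // -E.
  case/(thread_desc vV th yV) => [/(low _ yV)->|[i /andP[_ le] ->]].
    by exists ord0.
  have lt : i < n.+2 by rewrite ltnS leqW.
  by exists (Ordinal lt).
rewrite -[n.+2]card_ord; apply: leq_trans (subset_leq_card sub) _.
exact: leq_imset_card.
Qed.

(** * Surgery on a largest tree *)

Variables (e : rel T) (A : {set T}) (k lam : nat).
Hypothesis e_sym : symmetric e.
Hypothesis e_irr : irreflexive e.
Hypothesis ep : forall x, x \in V -> x != rho -> e x (p x).
Hypothesis leafE :
  forall x, (x \in A) = (x \in V) && ((x == rho) || (kids x == set0)).
Hypothesis card_A : #|A| = k.+1.
(** Every k-ended tree has at least lam vertices less than the given tree,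
    stated for the graphs of [order_ge_spanning_ends]. *)
Hypothesis order_gap :
  forall (V' : {set T}) (F' : {set T * T}) (A' : {set T}),
  V' != set0 -> spanning_ends e V' F' A' ->
  #|A'| + #|F'| + 1 <= #|V'| + k -> #|V'| + lam <= #|V|.
Hypothesis lam_gt0 : 0 < lam.
Hypothesis card_V : lam.+2 <= #|V|.

Lemma leafV x : x \in A -> x \in V.
Proof. by rewrite leafE => /andP[]. Qed.

Lemma leaf_kids x z : x \in A -> x != rho -> z \notin kids x.
Proof. by rewrite leafE => /andP[_ /orP[->//|/eqP-> _]]; rewrite inE. Qed.

Lemma desc_leaf l y : l \in A -> l != rho -> y \in V -> desc y l -> y = l.
Proof.
move=> lA lr yV d; apply/eqP/negP=> /negP ne.
by have [z zk _] := desc_kid yV d ne; have := leaf_kids z lA lr; rewrite zk.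
Qed.

Lemma parent_leaf x : x \in V -> p x \in A -> p x = rho.
Proof.
move=> xV pxA; apply/eqP/negP=> /negP ne; have := leaf_kids x pxA ne.
rewrite mem_kids xV eqxx andbT /=; case: eqVneq => // xr.
by rewrite xr p_rho eqxx in ne.
Qed.

Lemma inner_root x : x \in V -> x \notin A -> x != rho.
Proof. by move=> xV; rewrite leafE xV negb_or => /andP[]. Qed.

Lemma inner_kid x : x \in V -> x \notin A -> exists z, z \in kids x.
Proof. by move=> xV; rewrite leafE xV negb_or => /andP[_ /set0Pn]. Qed.

Lemma inner_single x : x \in V -> x \notin A -> single x \/ 1 < #|kids x|.
Proof.
move=> xV xA; rewrite /single (inner_root xV xA) /=.
have [z zk] := inner_kid xV xA.
have c0 : 0 < #|kids x| by apply/card_gt0P; exists z.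
by have [|le] := ltnP 1 #|kids x|; [right|left; rewrite eqn_leq le].
Qed.

Lemma single_inner x : single x -> x \notin A.
Proof.
case/andP=> xr k1; rewrite leafE (negbTE xr) negb_and; apply/orP; right.
by apply: contraTneq k1 => ->; rewrite cards0.
Qed.

Lemma kid_inner x z : x != rho -> z \in kids x -> x \notin A.
Proof. by move=> xr zk; apply/negP=> xA; have := leaf_kids z xA xr; rewrite zk. Qed.

Lemma rho_kid : exists2 z, z \in kids rho & forall y, y \in kids rho -> y = z.
Proof.
move/eqP/cards1P: kids_rho => [w ->]; exists w; rewrite ?inE // => y.
by rewrite inE => /eqP.
Qed.

Lemma kidP x z : z \in kids x -> [/\ z \in V, z != rho & p z = x].
Proof. by rewrite mem_kids => /and3P[? ? /eqP]. Qed.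

Lemma kid_neq_parent x : x \in V -> x != rho -> forall z, p z = x -> z \in V -> z != p x.
Proof.
move=> xV xr z pz zV; have zr : z != rho.
  by apply: contraNneq xr => zr; rewrite -pz zr p_rho.
have := hp zV zr; have := hp xV xr; rewrite pz => h1 h2.
by apply: contraTneq (ltn_trans h1 h2) => ->; rewrite ltnn.
Qed.

(** The g inner vertices of the path from v up to u are deleted, and the edges
    of Add are added. The deletion separates the part below v from the rest, and
    the edge ab of Add joins the two again. Among the vertices that were not
    leaves only u and v lose an edge, so only they can become ends, which the
    next two hypotheses exclude. With #|Add| = 1 the result is a tree, and with
    #|Add| = 2 it has one cycle; in both cases at most k - #|Add| + 1 ends are
    allowed. *)
Lemma cut_thread v g u (Add : {set T * T}) (A' : {set T}) :
    v \in V -> v \notin A -> thread v g -> u = iter g.+1 p v -> u \notin A ->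
    (forall x y, (x, y) \in Add -> [/\ x \in [set u; v], y \in A & e x y]) ->
    (exists a b, [/\ adj Add a b, desc a v & ~~ desc b v]) ->
    (exists2 y, adj Add u y & y != p u) \/ 1 < #|kids u| ->
    (exists2 z, z \in kids v &
      exists2 y, y != z & adj Add v y || (y \in kids v)) ->
    (forall x, x \in A -> x \notin A' ->
      exists y, [/\ adj Add x y, p x != y & p y != x]) ->
    #|A'| + #|Add| <= k.+1 ->
  lam <= g.
Proof.
move=> vV vA th uE uA AddP [a [b [ab av bv]]] Hu Hv HA le.
have vr := inner_root vV vA.
have uV : u \in V by rewrite uE; apply: iter_mem.
have ur := inner_root uV uA.
pose M := [set iter (val i).+1 p v | i : 'I_g].
have MP x : reflect (exists2 i, i < g & x = iter i.+1 p v) (x \in M).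
  apply: (iffP imsetP) => [[i _ ->]|[i lt ->]]; first by exists i.
  by exists (Ordinal lt).
have Ms x : x \in M -> single x.
  by case/MP=> i lt ->; apply: th; rewrite ltn0Sn.
have ltne i j : i < j -> i <= g -> iter j p v != iter i p v.
  move=> lt ig; apply: iter_neq => //; case: i ig {lt} => [//|i] ig.
  by have /andP[] := th i.+1 ig.
have MV : M \subset V by apply/subsetP=> x /MP[i _ ->]; apply: iter_mem.
have cM : #|M| = g.
  rewrite card_imset ?card_ord // => i j E; apply/val_inj/eqP.
  have [lt|lt|//] := ltngtP (val i) (val j).
    by have := ltne i.+1 j.+1 lt (ltn_ord i); rewrite E eqxx.
  by have := ltne j.+1 i.+1 lt (ltn_ord j); rewrite E eqxx.
have vM : v \notin M.
  by apply/MP=> -[i lt E]; have := ltne 0 i.+1 isT isT; rewrite -E eqxx.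
have uM : u \notin M.
  by apply/MP=> -[i lt E]; have := ltne i.+1 g.+1 lt lt; rewrite -uE E eqxx.
have uv : u != v by rewrite uE; apply: (ltne 0).
pose V' := V :\: M.
have cV' : #|V'| = #|V| - g by rewrite cardsD (setIidPr MV) cM.
have leafV' x : x \in A -> x \in V'.
  by move=> xA; rewrite inE leafV // andbT; apply: contraL xA => /Ms/single_inner.
have uV' : u \in V' by rewrite inE uV uM.
have vV' : v \in V' by rewrite inE vV vM.
pose U := rho |: (v |: M).
have cU : #|U| = g.+2.
  rewrite !cardsU1 vM cM !inE negb_or eq_sym vr /=.
  by rewrite (_ : rho \notin M) //; apply/negP=> /Ms /andP[/eqP].
have UV : U \subset V by rewrite !subUset !sub1set rhoV vV.
have geV : g.+2 <= #|V| by rewrite -cU subset_leq_card.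
pose F' := [set (y, p y) | y in V :\: U] :|: Add.
have cF : #|F'| <= #|V| - g.+2 + #|Add|.
  apply: (leq_trans (leq_card_setU _ _)); rewrite leq_add2r.
  by rewrite -cU -{2}(setIidPr UV) -cardsD leq_imset_card.
have keep y : y \in V' -> y != rho -> y != v -> adj F' y (p y).
  move=> /setDP[yV yM] yr yv; apply/orP; left; rewrite inE imset_f //.
  by rewrite !inE !negb_or yr yv yM.
have up y : p y \in M -> y \in V -> y = v \/ y \in M.
  move=> pM yV; have s := Ms _ pM; have [i lt E] := MP _ pM.
  have pr : p y != rho by case/andP: s.
  have yr : y != rho by apply: contraNneq pr => ->; rewrite p_rho.
  have yk : y \in kids (p y) by rewrite mem_kids yV yr eqxx.
  have ik : iter i p v \in kids (p y) by rewrite E iter_kid // -E.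
  rewrite (single_kid s yk ik); case: i {E ik} lt => [|i] lt; [by left|right].
  by apply/MP; exists i => //; apply: ltnW.
have pV' y : y \in V' -> y != v -> p y \in V'.
  case/setDP=> yV yM yv; rewrite inE pV // andbT; apply/negP=> /up.
  by case=> // [E|]; [rewrite E eqxx in yv|apply/negP].
have sF := sym_connect_sym (adj_sym F').
have Addadj x y : adj Add x y -> adj F' x y.
  by case/orP=> xy; apply/orP; [left|right]; rewrite inE xy orbT.
have sub x y : (x, y) \in F' -> [/\ x \in V', y \in V' & e x y].
  case/setUP=> [/imsetP[z /setDP[zV zU] [-> ->]]|/AddP[xuv yA exy]].
    have /and3P[zr zv zM] : [&& z != rho, z != v & z \notin M].
      by move: zU; rewrite !inE !negb_or.
    have zV' : z \in V' by rewrite inE zV zM.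
    by split=> //; [apply: pV'|apply: ep].
  by split=> //; [case/set2P: xuv => ->|apply: leafV'].
have subadj x y : adj F' x y -> [/\ x \in V', y \in V' & e x y].
  by case/orP=> /sub[? ? ?]; split=> //; rewrite e_sym.
have conr x : x \in V' -> ~~ desc x v -> connect (adj F') x rho.
  have [n] := ubnP (h x); elim: n x => // n IH x lt xV' nd.
  have [-> //|xr] := eqVneq x rho.
  have xv : x != v by apply: contraNneq nd => ->.
  apply: connect_trans (connect1 (keep x xV' xr xv)) (IH _ _ (pV' x xV' xv) _).
    by apply: leq_trans (ltnSE lt); apply: hp => //; case/setDP: xV'.
  by apply: contra nd; apply: desc_p.
have conv x : x \in V' -> desc x v -> connect (adj F') x v.
  move=> + /iter_findex; move: (findex _ _ _) => i.
  elim: i x => [x _ /= -> //|i IH x xV']; rewrite iterSr => E.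
  have [-> //|xv] := eqVneq x v.
  have xr : x != rho by apply: contraNneq vr => xr; rewrite -E xr p_rho iter_root.
  by apply: connect_trans (connect1 (keep x xV' xr xv)) (IH _ (pV' x xV' xv) E).
have [aV' bV' _] := subadj _ _ (Addadj _ _ ab).
have con x : x \in V' -> connect (adj F') x rho.
  move=> xV'; case: (boolP (desc x v)) => [d|]; last exact: conr.
  apply: connect_trans (conv x xV' d) _.
  apply: connect_trans (conr b bV' bv); rewrite sF.
  apply: connect_trans (conv a aV' av).
  by rewrite sF; apply/connect1/Addadj.
have kidV' x z : x \notin M -> x != u -> z \in kids x -> z \in V' /\ adj F' x z.
  move=> xM xu /kidP[zV zr pz]; have zM : z \notin M.
    apply/MP=> -[i lt E]; move: pz; rewrite E -[p _]/(iter i.+2 p v) => pz.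
    have [lt'|eq] := ltnP i.+1 g.
      by case/MP: xM; exists i.+1.
    case/eqP: xu; rewrite -pz uE; congr (iter _ p v).
    by apply/eqP; rewrite eqn_leq !ltnS eq lt.
  have zV' : z \in V' by rewrite inE zV zM.
  split=> //; rewrite adj_sym -pz; apply: keep => //.
  apply: contraNneq xM => zv; move: pz; rewrite zv => pv.
  case: (g) uE MP => [|g'] uE MP; first by rewrite -pv uE eqxx in xu.
  by apply/MP; exists 0.
have V'0 : V' != set0 by apply/set0Pn; exists u.
suff sp : spanning_ends e V' F' A'.
  have := order_gap V'0 sp; rewrite cV'; move: le cF geV.
  by move: #|V| #|A'| #|F'| #|Add|; clear; lia.
split=> //.
  by move=> x y xV' yV'; apply: connect_trans (con x xV') _; rewrite sF con.
move=> x xV' xA'.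
have [xV xM] := setDP xV'.
have [xA|xA] := boolP (x \in A).
  have [y [xy px py]] := HA x xA xA'.
  have xu : x != u by apply: contraNneq uA => <-.
  have xv : x != v by apply: contraNneq vA => <-.
  have [xr|xr] := eqVneq x rho.
    have [z zk _] := rho_kid; exists y, z; rewrite (Addadj _ _ xy).
    rewrite -xr in zk; have [_ _ pz] := kidP zk.
    have [_ ->] := kidV' x z xM xu zk; split=> //.
    by apply: contraNneq py => ->; rewrite pz.
  by exists (p x), y; split=> //; [exact: keep|exact: Addadj].
have xr := inner_root xV xA.
have [xu|xu] := eqVneq x u.
  have au : adj F' x (p x) by apply: keep; rewrite // xu.
  rewrite -xu in Hu; case: Hu => [[y uy yp]|].
    by exists y, (p x); split=> //; apply: Addadj.
  rewrite (cardsD1 (iter g p v)) => k2.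
  have /card_gt0P[z] : 0 < #|kids x :\ iter g p v|.
    by move: k2; case: (_ \in _); rewrite ?add0n; [|apply: ltn_trans].
  case/setD1P=> zg /kidP[zV zr pz]; exists z, (p x); split=> //.
    exact: kid_neq_parent pz zV.
  have zi i : i <= g -> z != iter i p v.
    rewrite leq_eqVlt => /orP[/eqP-> //|lt]; apply: contraTneq (ltne i.+1 g.+1 lt lt).
    by move=> E; rewrite negbK -uE -xu -pz E.
  rewrite adj_sym -pz; apply: keep => //; last exact: (zi 0).
  rewrite inE zV andbT; apply/MP=> -[i lt E].
  by have := zi _ lt; rewrite E eqxx.
have [xv|xv] := eqVneq x v.
  have [z zk [y yz yv]] := Hv; rewrite -xv in zk yv.
  have [_ xz] := kidV' x z xM xu zk; exists y, z; split=> //.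
  by case/orP: yv => [/Addadj //|yk]; have [] := kidV' x y xM xu yk.
have [z zk] := inner_kid xV xA; have [_ xz] := kidV' x z xM xu zk.
have [zV zr pz] := kidP zk.
exists z, (p x); split=> //; [exact: kid_neq_parent pz zV|exact: keep].
Qed.

(** The n vertices of the path from the leaf l to the vertex v, without v, are
    deleted, and the edges of Add are added at v. The result is connected without
    Add, so each added edge closes a cycle. For n = 0 nothing is deleted, and l
    itself is the vertex at which the edges are added. *)
Lemma prune_pendant l n v (Add : {set T * T}) (A' : {set T}) :
    l \in A -> l != rho -> thread l n.-1 -> v = iter n p l -> v != rho ->
    (forall x y, (x, y) \in Add -> [/\ x = v, y \in A, y != l & e x y]) ->
    (n = 0 \/ 1 < #|kids v| \/ exists2 y, adj Add v y & y != p v) ->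
    (forall x, x \in A -> x \notin A' -> (0 < n /\ x = l) \/
      exists y, [/\ adj Add x y, p x != y & p y != x]) ->
    #|A'| + #|Add| <= k ->
  lam <= n.
Proof.
move=> lA lr th vE vr AddP Hv HA le; have lV := leafV lA.
have vV : v \in V by rewrite vE; apply: iter_mem.
pose M := [set iter (val i) p l | i : 'I_n].
have MP x : reflect (exists2 i, i < n & x = iter i p l) (x \in M).
  apply: (iffP imsetP) => [[i _ ->]|[i lt ->]]; first by exists i.
  by exists (Ordinal lt).
have ths i : 0 < i -> i < n -> single (iter i p l).
  by move=> i0 lt; apply: th; rewrite i0 -ltnS prednK // (leq_trans _ lt).
have ltr i : i <= n -> iter i p l != rho.
  by move=> lt; apply: contraNneq vr => E; rewrite vE (iter_root_le lt E).
have ltne i j : i < j -> j <= n -> iter j p l != iter i p l.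
  by move=> lt jn; apply: iter_neq (ltr _ _) => //; apply: ltnW (leq_trans lt jn).
have MV : M \subset V by apply/subsetP=> x /MP[i _ ->]; apply: iter_mem.
have cM : #|M| = n.
  rewrite card_imset ?card_ord // => i j E; apply/val_inj/eqP.
  have [lt|lt|//] := ltngtP (val i) (val j).
    by have := ltne _ _ lt (ltnW (ltn_ord j)); rewrite E eqxx.
  by have := ltne _ _ lt (ltnW (ltn_ord i)); rewrite E eqxx.
have vM : v \notin M.
  by apply/MP=> -[i lt E]; have := ltne i n lt (leqnn n); rewrite -vE E eqxx.
have rM : rho \notin M.
  by apply/MP=> -[i lt E]; have := ltr i (ltnW lt); rewrite -E eqxx.
pose V' := V :\: M.
have cV' : #|V'| = #|V| - n by rewrite cardsD (setIidPr MV) cM.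
have leafV' x : x \in A -> x != l -> x \in V'.
  move=> xA xl; rewrite inE leafV // andbT; apply/MP=> -[[|i] lt E].
    by rewrite E eqxx in xl.
  by have := single_inner (ths i.+1 isT lt); rewrite -E xA.
have vV' : v \in V' by rewrite inE vV vM.
pose U := rho |: M.
have cU : #|U| = n.+1 by rewrite cardsU1 rM cM.
have UV : U \subset V by rewrite !subUset !sub1set rhoV.
have geV : n.+1 <= #|V| by rewrite -cU subset_leq_card.
pose F' := [set (y, p y) | y in V :\: U] :|: Add.
have cF : #|F'| <= #|V| - n.+1 + #|Add|.
  apply: (leq_trans (leq_card_setU _ _)); rewrite leq_add2r.
  by rewrite -cU -{2}(setIidPr UV) -cardsD leq_imset_card.
have keep y : y \in V' -> y != rho -> adj F' y (p y).
  move=> /setDP[yV yM] yr; apply/orP; left; rewrite inE imset_f //.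
  by rewrite !inE !negb_or yr yM.
have up y : p y \in M -> y \in V -> y != rho -> y \in M.
  move=> pM yV yr; have [i lt E] := MP _ pM.
  have yk : y \in kids (p y) by rewrite mem_kids yV yr eqxx.
  case: i lt E => [|i] lt E; first by rewrite E (negPf (leaf_kids _ lA lr)) in yk.
  have s : single (p y) by rewrite E; apply: ths.
  have ik : iter i p l \in kids (p y) by rewrite E iter_kid // -E; case/andP: s.
  by rewrite (single_kid s yk ik); apply/MP; exists i => //; apply: ltnW.
have pV' y : y \in V' -> p y \in V'.
  case/setDP=> yV yM; have [->|yr] := eqVneq y rho.
    by rewrite p_rho inE rhoV rM.
  by rewrite inE pV // andbT; apply: contra yM => /up; apply.
have sF := sym_connect_sym (adj_sym F').
have Addadj x y : adj Add x y -> adj F' x y.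
  by case/orP=> xy; apply/orP; [left|right]; rewrite inE xy orbT.
have sub x y : (x, y) \in F' -> [/\ x \in V', y \in V' & e x y].
  case/setUP=> [/imsetP[z /setDP[zV zU] [-> ->]]|/AddP[-> yA yl exy]].
    have /andP[zr zM] : (z != rho) && (z \notin M).
      by move: zU; rewrite !inE !negb_or.
    have zV' : z \in V' by rewrite inE zV zM.
    by split=> //; [apply: pV'|apply: ep].
  by split=> //; apply: leafV'.
have con x : x \in V' -> connect (adj F') x rho.
  have [m] := ubnP (h x); elim: m x => // m IH x lt xV'.
  have [-> //|xr] := eqVneq x rho.
  apply: connect_trans (connect1 (keep x xV' xr)) (IH _ _ (pV' x xV')).
  by apply: leq_trans (ltnSE lt); apply: hp => //; case/setDP: xV'.
have kidV' x z : x \notin M -> x != v -> z \in kids x -> z \in V' /\ adj F' x z.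
  move=> xM xv /kidP[zV zr pz]; have zM : z \notin M.
    apply/MP=> -[i lt E]; move: pz; rewrite E -[p _]/(iter i.+1 p l) => pz.
    have [lt'|eq] := ltnP i.+1 n.
      by case/MP: xM; exists i.+1.
    case/eqP: xv; rewrite -pz vE; congr (iter _ p l).
    by apply/eqP; rewrite eqn_leq eq lt.
  have zV' : z \in V' by rewrite inE zV zM.
  by split=> //; rewrite adj_sym -pz; apply: keep.
have V'0 : V' != set0 by apply/set0Pn; exists v.
suff sp : spanning_ends e V' F' A'.
  have := order_gap V'0 sp; rewrite cV'; move: le cF geV.
  by move: #|V| #|A'| #|F'| #|Add|; clear; lia.
split=> //.
  by move=> x y xV' yV'; apply: connect_trans (con x xV') _; rewrite sF con.
move=> x xV' xA'.
have [xV xM] := setDP xV'.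
have [xA|xA] := boolP (x \in A).
  have [[n0 xl]|[y [xy px py]]] := HA x xA xA'.
    by case/MP: xM; exists 0.
  have [xr|xr] := eqVneq x rho.
    have [z zk _] := rho_kid; exists y, z; rewrite (Addadj _ _ xy).
    rewrite -xr in zk; have [_ _ pz] := kidP zk.
    have xv : x != v by rewrite xr eq_sym.
    have [_ ->] := kidV' x z xM xv zk; split=> //.
    by apply: contraNneq py => ->; rewrite pz.
  by exists (p x), y; split=> //; [exact: keep|exact: Addadj].
have xr := inner_root xV xA.
have [xv|xv] := eqVneq x v.
  have av : adj F' x (p x) by apply: keep; rewrite // xv.
  have n0 : n != 0 by apply: contraNneq xA => n0; rewrite xv vE n0.
  rewrite -xv in Hv; case: Hv => [/eqP|[|[y vy yp]]]; first by rewrite (negPf n0).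
    rewrite (cardsD1 (iter n.-1 p l)) => k2.
    have /card_gt0P[z] : 0 < #|kids x :\ iter n.-1 p l|.
      by move: k2; case: (_ \in _); rewrite ?add0n; [|apply: ltn_trans].
    case/setD1P=> zg /kidP[zV zr pz]; exists z, (p x); split=> //.
      exact: kid_neq_parent pz zV.
    rewrite adj_sym -pz; apply: keep => //.
    rewrite inE zV andbT; apply/MP=> -[i lt E].
    move: lt; rewrite leq_eqVlt => /orP[/eqP En|lt].
      by rewrite E -En eqxx in zg.
    have := ltne i.+1 n lt (leqnn n).
    by rewrite -vE -xv -pz E eqxx.
  by exists y, (p x); split=> //; apply: Addadj.
have [z zk] := inner_kid xV xA; have [_ xz] := kidV' x z xM xv zk.
have [zV zr pz] := kidP zk.
exists z, (p x); split=> //; [exact: kid_neq_parent pz zV|exact: keep].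
Qed.

Lemma card_leaves_del2 x y : x \in A -> y \in A -> x != y ->
  #|A :\ x :\ y|.+2 = k.+1.
Proof.
move=> xA yA xy; have := cardsD1 x A; have := cardsD1 y (A :\ x).
by rewrite !inE eq_sym xy yA xA card_A /= => -> ->.
Qed.

Lemma adj_edge x y a b :
  adj [set (x, y)] a b = (a == x) && (b == y) || (b == x) && (a == y).
Proof. by rewrite /adj !inE !xpair_eqE. Qed.

(** If v branches, then deleting the path to l gets rid of the leaf l. *)
Lemma prune_branch l n : l \in A -> l != rho -> 0 < n -> thread l n.-1 ->
  1 < #|kids (iter n p l)| -> lam <= n.
Proof.
move=> lA lr n0 th k2.
apply: (@prune_pendant l n _ set0 (A :\ l) lA lr th erefl).
- by apply: contraTneq k2 => ->; rewrite kids_rho.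
- by move=> x y; rewrite inE.
- by right; left.
- move=> x xA; rewrite !inE xA andbT negbK => /eqP->; by left.
- by have := cardsD1 l A; rewrite lA card_A cards0 addn0 => -[->].
Qed.

Lemma thread_low l n y : l \in A -> l != rho -> y \in V -> thread l n ->
  desc y (iter n p l) -> exists2 i, i <= n & y = iter i p l.
Proof.
move=> lA lr yV th /(thread_desc (leafV lA) th yV)[/(desc_leaf lA lr yV)->|].
  by exists 0.
by case=> i /andP[_ le] ->; exists i.
Qed.

(** Joining v to another leaf l' after the deletion gets rid of both l and l'
    at the price of one cycle. *)
Lemma prune_edge l n l' : l \in A -> l != rho -> thread l n ->
  l' \in A -> l' != l -> e (iter n p l) l' -> lam <= n.
Proof.
move=> lA lr th l'A ll' el'; set v := iter n p l in el'.
have lV := leafV lA.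
have vr : v != rho.
  by rewrite /v; case: n th {el' v} => // n th; case/andP: (th n.+1 (ltnSn _)).
have vV : v \in V by apply: iter_mem.
(* If vl' is an edge of the tree, then the tree is a path from l to l', and the
   bound holds because #|V| is at least lam + 2. *)
have [pv|pv] := eqVneq (p v) l'.
  have pvr : p v = rho by apply: parent_leaf => //; rewrite pv.
  have := @card_thread_root l n lV th vr pvr.
  move=> /(_ (fun y yV => desc_leaf lA lr yV)); move: card_V.
  by move: #|V| => c; clear; lia.
have pl' : p l' != v.
  apply/eqP=> E; have l'k : l' \in kids v.
    rewrite mem_kids leafV // E eqxx andbT /=.
    by apply: contraNneq vr => Er; rewrite -E Er p_rho.
  case: (posnP n) => [n0|n0].
    by have := leaf_kids l' lA lr; rewrite /v n0 in l'k; rewrite l'k.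
  have s : single v by apply: th; rewrite n0 leqnn.
  have : iter n.-1 p l \in kids v.
    by rewrite /v -{2}(prednK n0); apply: iter_kid; rewrite // prednK.
  move/(single_kid s l'k); case: (n) n0 th => [//|[|m]] _ th E'.
    by rewrite E' eqxx in ll'.
  have : single l' by rewrite E'; apply: th; rewrite /= ltnW.
  by move/single_inner; rewrite l'A.
apply: (@prune_pendant l n v [set (v, l')] (A :\ l :\ l') lA lr) => //.
- by apply: thread_le th; apply: leq_pred.
- by move=> x y; rewrite inE => /eqP[-> ->].
- by right; right; exists l'; rewrite ?adj_edge ?eqxx // eq_sym.
- move=> x xA; rewrite !inE xA andbT -negb_or negbK => /orP[]/eqP->.
    by right; exists v; rewrite adj_edge !eqxx /= orbT.
  case: (posnP n) => [n0|n0]; [right|by left].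
  have E : v = l by rewrite /v n0.
  by exists l'; rewrite adj_edge -E !eqxx; split=> //; rewrite E.
- rewrite cards1; have := card_leaves_del2 lA l'A; rewrite eq_sym => /(_ ll').
  by move: #|_| => c; clear; lia.
Qed.

(** Two adjacent leaves could be joined without deleting any vertex. *)
Lemma leaf_nbr_inner l v : l \in A -> v \in V -> e v l -> v \notin A.
Proof.
move=> lA vV evl; apply/negP=> vA.
have vl : v != l by apply: contraTneq evl => ->; rewrite e_irr.
have th x : thread x 0 by move=> [|i].
suff : lam <= 0 by rewrite leqn0; case: (lam) lam_gt0.
have [vr|vr] := eqVneq v rho.
  by apply: (@prune_edge l 0 v); rewrite // /= 1?e_sym // -vr eq_sym.
by apply: (@prune_edge v 0 l); rewrite // eq_sym.
Qed.

Lemma iter_not_desc v g : v \in V -> v != rho -> ~~ desc (iter g.+1 p v) v.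
Proof.
move=> vV vr; apply/negP=> d; have E := desc_anti vV (fconnect_iter p g.+1 v) d.
by have := height_iter vV vr (ltn0Sn g); rewrite -E ltnn.
Qed.

Lemma desc_parent x y : desc x y -> x != y -> desc (p x) y.
Proof.
move/iter_findex; case: (findex _ _ _) => [/= -> /eqP//|i].
by rewrite iterSr => <- _; apply: fconnect_iter.
Qed.

Lemma thread_inner v g i :
  v \notin A -> thread v g -> i <= g -> iter i p v \notin A.
Proof. by case: i => // i _ th le; apply/single_inner/th. Qed.

Lemma parent_thread_neq v g l :
  v \in V -> thread v g -> iter g.+1 p v \notin A -> l \in A -> p v != l.
Proof.
move=> vV; case: g => [|g] th uA lA; apply: contraTneq lA => <- //.
exact: single_inner (th 1 _).
Qed.

(** Deleting the inside of the path from v up to u and adding the edges ul and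
    vl' removes the ends l and l' and creates one cycle. In the first case the
    edge vl', in the second case the edge ul keeps the graph connected. The
    position of l and l' and the condition on u or v being single exclude that
    ul or vl' is an edge of the tree, whose addition would remove no end. *)
Lemma leaf_nbrs_far v g l l' : v \in V -> v \notin A -> thread v g ->
    iter g.+1 p v \notin A -> l \in A -> l' \in A -> l != l' ->
    e (iter g.+1 p v) l -> e v l' ->
    (~~ desc l' v /\ (desc l v \/ single (iter g.+1 p v))) \/
    [/\ desc l' v, desc l v & single v] ->
  lam <= g.
Proof.
move=> vV vA th uA lA l'A ll' eul evl' H; set u := iter g.+1 p v in uA eul H.
have vr := inner_root vV vA.
have uV : u \in V by apply: iter_mem.
have ur := inner_root uV uA.
have lv : l != v by apply: contraNneq vA => <-.
have uv : ~~ desc u v by apply: iter_not_desc.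
have gk : iter g p v \in kids u by apply: iter_kid.
have pul : p u != l.
  apply/eqP=> E; have lr : l = rho by rewrite -E; apply: parent_leaf; rewrite ?E.
  have ndl : ~~ desc l v by rewrite lr; apply: contra vr => /desc_root_eq/eqP.
  case: H => [[nd [d|s]]|[_ d _]]; try by rewrite d in ndl.
  have th1 := thread_add th s.
  case: (thread_root vV th1 ur _ (leafV l'A)) => [|E'|].
  - by rewrite /= -/u E.
  - by rewrite lr E' eqxx in ll'.
  case/(thread_desc vV th1 (leafV l'A)) => [d|[i /andP[i0 le] E']].
    by rewrite d in nd.
  have /single_inner : single (iter i p v) by apply: th1; rewrite i0.
  by rewrite -E' l'A.
have plu : p l != u.
  apply/eqP=> E; have lk : l \in kids u.
    rewrite mem_kids leafV // E eqxx andbT /=.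
    by apply: contraNneq ur => Er; rewrite -E Er p_rho.
  have nd : ~~ desc l v.
    by apply: contra uv => d; rewrite -E; apply: desc_parent.
  case: H => [[_ [d|s]]|[_ d _]]; try by rewrite d in nd.
  have := thread_inner vA th (leqnn g).
  by rewrite -(single_kid s lk gk) lA.
have pvl' := parent_thread_neq vV th uA l'A.
have pl'v : p l' != v.
  apply/eqP=> E; have d' : desc l' v by rewrite -E fconnect1.
  case: H => [[]|[_ d s]]; first by rewrite d'.
  have [z zk lz] := desc_kid (leafV lA) d lv.
  have l'k : l' \in kids v.
    rewrite mem_kids leafV // E eqxx andbT /=.
    by apply: contraNneq vr => Er; rewrite -E Er p_rho.
  have [_ l'r _] := kidP l'k.
  rewrite (single_kid s zk l'k) in lz.
  by rewrite (desc_leaf l'A l'r (leafV lA) lz) eqxx in ll'.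
have adjU : adj [set (u, l); (v, l')] u l by rewrite /adj !inE eqxx.
have adjV : adj [set (u, l); (v, l')] v l' by rewrite /adj !inE eqxx orbT.
apply: (@cut_thread v g u [set (u, l); (v, l')] (A :\ l :\ l')) => //.
- by move=> x y; rewrite !inE => /orP[]/eqP[-> ->]; rewrite eqxx ?orbT.
- case: H => [[nd _]|[_ d _]]; first by exists v, l'; rewrite connect0.
  by exists l, u; rewrite adj_sym.
- by left; exists l; rewrite // eq_sym.
- have [z zk] := inner_kid vV vA; exists z => //; exists l'; rewrite ?adjV //.
  by apply: contraNneq pl'v => ->; have [_ _ ->] := kidP zk.
- move=> x xA; rewrite !inE xA andbT -negb_or negbK => /orP[]/eqP->.
    by exists v; rewrite adj_sym.
  by exists u; rewrite adj_sym.
- have := card_leaves_del2 lA l'A ll'; have : #|[set (u, l); (v, l')]| <= 2.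
    by rewrite cards2; case: (_ != _).
  by move: #|_| #|_|; clear; lia.
Qed.

Lemma card_leaves_del l : l \in A -> #|A :\ l| = k.
Proof. by move=> lA; have := cardsD1 l A; rewrite lA card_A => -[->]. Qed.

Lemma branch_root x : 1 < #|kids x| -> x != rho.
Proof. by apply: contraTneq => ->; rewrite kids_rho. Qed.

Lemma branch_inner x : 1 < #|kids x| -> x \notin A.
Proof.
move=> k2; have xr := branch_root k2.
have /card_gt0P[z] : 0 < #|kids x| by apply: ltnW.
exact: kid_inner.
Qed.

(** The branching vertex at the upper end of the path does not become an end, so
    the edge vl alone suffices to save one leaf. *)
Lemma branch_above v g l : v \in V -> v \notin A -> thread v g ->
    1 < #|kids (iter g.+1 p v)| -> l \in A -> e v l -> ~~ desc l v ->
  lam <= g.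
Proof.
move=> vV vA th k2 lA evl nd.
have pvl := parent_thread_neq vV th (branch_inner k2) lA.
have plv : p l != v by apply: contraNneq nd => <-; apply: fconnect1.
apply: (@cut_thread v g _ [set (v, l)] (A :\ l) vV vA th erefl (branch_inner k2)).
- by move=> x y; rewrite inE => /eqP[-> ->]; rewrite !inE eqxx orbT.
- by exists v, l; rewrite adj_edge !eqxx connect0.
- by right.
- have [z zk] := inner_kid vV vA; exists z => //; exists l.
    by apply: contraNneq plv => ->; have [_ _ ->] := kidP zk.
  by rewrite adj_edge !eqxx.
- move=> x xA; rewrite !inE xA andbT negbK => /eqP->; exists v.
  by rewrite adj_edge !eqxx orbT.
- by rewrite cards1 card_leaves_del // addn1.
Qed.

(** As in [branch_above], with the branching vertex at the lower end. *)
Lemma branch_below v g l : v \in V -> thread v g -> 1 < #|kids v| ->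
    iter g.+1 p v \notin A -> l \in A -> e (iter g.+1 p v) l -> desc l v ->
  lam <= g.
Proof.
move=> vV th k2 uA lA eul d; set u := iter g.+1 p v in uA eul.
have vA := branch_inner k2; have vr := branch_root k2.
have uV : u \in V by apply: iter_mem.
have ur := inner_root uV uA.
have uv : ~~ desc u v by apply: iter_not_desc.
have lv : l != v by apply: contraNneq vA => <-.
have plu : p l != u.
  by apply: contraNneq uv => <-; apply: desc_parent.
have pul : p u != l.
  apply/eqP=> E; have lr : l = rho by rewrite -E; apply: parent_leaf; rewrite ?E.
  by move: d; rewrite lr => /desc_root_eq/eqP; rewrite (negPf vr).
apply: (@cut_thread v g u [set (u, l)] (A :\ l) vV vA th erefl uA).
- by move=> x y; rewrite inE => /eqP[-> ->]; rewrite !inE eqxx.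
- by exists l, u; rewrite adj_edge !eqxx orbT.
- by left; exists l; rewrite ?adj_edge ?eqxx // eq_sym.
- have /card_gt1P[z [y [zk yk zy]]] := k2.
  by exists z => //; exists y; rewrite ?yk ?orbT // eq_sym.
- move=> x xA; rewrite !inE xA andbT negbK => /eqP->; exists u.
  by rewrite adj_edge !eqxx orbT.
- by rewrite cards1 card_leaves_del // addn1.
Qed.

(** * Charging the leaf neighbours to vertices of the tree *)

Variable S : {set T}.
Hypothesis SA : S \subset A.
Hypothesis rhoS : rho \in S.
Hypothesis card_S : #|S| <= lam.+1.
Hypothesis nbrA : forall l v, l \in A -> e l v -> v \in V.

Definition below x := [set s in S | desc s x].

(** Position of v relative to x: if l lies below x, then v is above x at a
    distance from 1 to #|below x|; otherwise v is below x, or equal to x, at a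
    distance less than #|S :\: below x|. Different leaves on the same side
    have different distances. Two distances on opposite sides add up to less
    than #|S|, so two vertices charged to x are at most lam apart. *)
Definition charged v l x := [/\ x \in V, x != rho &
  if l \in below x then
    iter (index l (enum (below x))).+1 p x = v /\
    thread x (index l (enum (below x)))
  else
    iter (index l (enum (S :\: below x))) p v = x /\
    thread v (index l (enum (S :\: below x)))].

Lemma index_lt (B : {set T}) x : x \in B -> index x (enum B) < #|B|.
Proof. by move=> xB; rewrite cardE index_mem mem_enum. Qed.

Lemma index_enum_inj (B : {set T}) x y : x \in B -> y \in B ->
  index x (enum B) = index y (enum B) -> x = y.
Proof.
move=> xB yB E; rewrite -[x](nth_index x (s := enum B)) ?mem_enum // E.
by rewrite nth_index // mem_enum.
Qed.

Lemma mem_below s x : (s \in below x) = (s \in S) && desc s x.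
Proof. by rewrite inE. Qed.

Lemma belowS x : below x \subset S.
Proof. by apply/subsetP=> s; rewrite mem_below => /andP[]. Qed.

Lemma card_below x : #|below x| + #|S :\: below x| <= lam.+1.
Proof.
by apply: leq_trans card_S; rewrite -(cardsID (below x) S) (setIidPr (belowS x)).
Qed.

(** The root is a leaf of S that is not below x. *)
Lemma card_below_le x : x != rho -> #|below x| <= lam.
Proof.
move=> xr; have := card_below x; rewrite (cardsD1 rho (_ :\: _)) !inE rhoS /=.
have -> : desc rho x = false.
  by apply: contraNF xr => /desc_root_eq ->.
by rewrite /= addnCA add1n ltnS => /(leq_trans _); apply; apply: leq_addr.
Qed.

Lemma below_thread v n : v \in V -> thread v n -> below (iter n p v) = below v.
Proof.
move=> vV th; apply/setP=> s; rewrite !mem_below; have [sS|//] := boolP (s \in S).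
have sA := subsetP SA s sS; apply/idP/idP=> /= [d|d]; last first.
  exact: connect_trans d (fconnect_iter p n v).
case: (thread_desc vV th (leafV sA) d) => // -[i /th/single_inner +  E].
by rewrite -E sA.
Qed.

Lemma thread_cat v m n : thread v m -> thread (iter m p v) n -> thread v (m + n).
Proof.
move=> thm thn i /andP[i0 le]; have [im|mi] := leqP i m; first by apply: thm; rewrite i0.
rewrite -(subnK (ltnW mi)) iterD; apply: thn; rewrite subn_gt0 mi /=.
by rewrite leq_subLR.
Qed.

(** The walk from v to x has at most lam steps. If it met a branching vertex,
    this vertex would be too close to v by [branch_below] or [branch_above]. A
    walk down stops before l, since only l is below itself and the required
    distance is then 1. A walk up stops before the root, since all of S but the
    root lies below the unbranched path from the root, and the required distance
    is then 0. *)
Lemma charge_exists v l : v \in V -> l \in S -> e v l -> exists x, charged v l x.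
Proof.
move=> vV lS evl; have lA := subsetP SA l lS.
have vA := leaf_nbr_inner lA vV evl; have vr := inner_root vV vA.
have [ld|lnd] := boolP (l \in below v).
  have /andP[_ dl] : (l \in S) && desc l v by rewrite -mem_below.
  have lv : l != v by apply: contraNneq vA => <-.
  have [z zk lz] := desc_kid (leafV lA) dl lv; have [zV zr pz] := kidP zk.
  have lr : l != rho by apply: contraNneq zr => lr; apply/eqP/desc_root_eq; rewrite -lr.
  set i := index l (enum (below z)).
  have lbz : l \in below z by rewrite mem_below lS.
  have ilt : i < #|below z| by apply: index_lt.
  have [x [xV xz th lx]] : exists x, [/\ x \in V, iter i p x = z, thread x i & desc l x].
    have : i <= i by [].
    elim: {-2}i => [_|n IH lt]; first by exists z; split=> // -[].
    have [x [xV xz th lx]] := IH (ltnW lt).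
    have xr : x != rho by apply: contraNneq zr => xr; rewrite -xz xr iter_root.
    have lnx : l != x.
      apply/eqP=> E; suff le : #|below z| <= 1.
        by have := leq_trans lt (ltnSE (leq_trans ilt le)).
      rewrite -xz (below_thread xV th) -(cards1 l); apply: subset_leq_card.
      apply/subsetP=> s; rewrite mem_below inE -E => /andP[sS sl].
      by apply/eqP/desc_leaf => //; apply/leafV/(subsetP SA).
    have [w wk lw] := desc_kid (leafV lA) lx lnx; have [wV wr pw] := kidP wk.
    have [s|k2] := inner_single xV (kid_inner xr wk).
      exists w; split=> //; first by rewrite iterSr pw.
      exact: thread_cons pw s th.
    have uE : iter n.+1 p x = v by rewrite /= xz.
    have := @branch_below x n l xV th k2; rewrite uE => /(_ vA lA evl lx) le.
    have le' := leq_trans (card_below_le zr) le.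
    by have := leq_trans (ltn_trans lt ilt) le'; rewrite ltnn.
  have bE : below x = below z by rewrite -xz (below_thread xV th).
  exists x; split=> //.
    by apply: contraNneq zr => xr; rewrite -xz xr iter_root.
  by rewrite bE lbz -/i /= xz.
set c := index l (enum (S :\: below v)).
have lS' : l \in S :\: below v by rewrite inE lS andbT.
have clt : c < #|S :\: below v| by apply: index_lt.
have cl : c <= lam.
  have := card_below v; move: clt; move: #|_| #|_| c; clear; lia.
have th : thread v c.
  have : c <= c by [].
  elim: {-2}c => [_ []//|n IH lt]; have thn := IH (ltnW lt); apply: thread_add => //.
  have nr : iter n p v != rho.
    by case: (n) thn => [//|n'] /(_ n'.+1 (ltnSn _)) /andP[].
  have [zr|zr] := eqVneq (iter n.+1 p v) rho.
    suff le : #|S :\: below v| <= 1.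
      by have := leq_trans lt (ltnSE (leq_trans clt le)).
    rewrite -(cards1 rho); apply/subset_leq_card/subsetP=> s.
    rewrite !inE => /andP[+ sS]; rewrite sS /= => nd.
    have sV := leafV (subsetP SA s sS).
    case: (thread_root vV thn nr zr sV) => [->//|d].
    have : s \in below (iter n p v) by rewrite mem_below sS.
    by rewrite below_thread // mem_below sS (negPf nd).
  have nk := iter_kid vV zr.
  have [//|k2] := inner_single (iter_mem _ vV) (kid_inner zr nk).
  have nd : ~~ desc l v by move: lnd; rewrite mem_below lS.
  have le := branch_above vV vA thn k2 lA evl nd.
  by have := leq_trans lt (leq_trans cl le); rewrite ltnn.
have bE : below (iter c p v) = below v by apply: below_thread.
exists (iter c p v); split; first exact: iter_mem.
  by case: (c) th => [//|c'] /(_ c'.+1 (ltnSn _)) /andP[].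
by rewrite bE (negPf lnd).
Qed.

(** Otherwise v and v' would lie above x on one thread, too close together. *)
Lemma charge_below v l v' l' x : v \in V -> l \in S -> e v l ->
    v' \in V -> l' \in S -> e v' l' -> charged v l x -> charged v' l' x ->
    l \in below x -> l' \in below x ->
  ~~ (index l (enum (below x)) < index l' (enum (below x))).
Proof.
move=> vV lS evl v'V l'S evl' [xV xr Hl] [_ _ Hl'] lb lb'.
rewrite lb lb' in Hl Hl'.
have := index_lt lb'; move: Hl Hl'.
set i := index _ _; set i' := index _ _ => -[iE thi] [iE' thi'] ilt'.
apply/negP=> lt; have ine : l != l'.
  by apply/eqP=> E; move: lt; rewrite /i /i' E ltnn.
have lA := subsetP SA l lS; have l'A := subsetP SA l' l'S.
have vA := leaf_nbr_inner lA vV evl; have vA' := leaf_nbr_inner l'A v'V evl'.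
have uE : iter (i' - i.+1).+1 p v = v'.
  by rewrite -iE -iterD -iE'; congr (iter _ p x); rewrite addSn subnK.
have th : thread v (i' - i.+1) by rewrite -iE; apply: thread_iter; rewrite subnKC.
have := @leaf_nbrs_far v (i' - i.+1) l' l vV vA th; rewrite uE eq_sym ine.
move=> /(_ vA' l'A lA isT evl' evl) H; suff : lam <= i' - i.+1.
  by have := card_below_le xr; move: ilt' lt; clearbody i i'; move: #|_|; clear; lia.
apply: H; right; move: lb lb'; rewrite !mem_below lS l'S /= => dl dl'.
have xv : desc x v by rewrite -iE fconnect_iter.
split; [exact: connect_trans dl xv|exact: connect_trans dl' xv|].
by rewrite -iE; apply: thi'.
Qed.

(** Otherwise v' would lie below v on one thread, too close to v. *)
Lemma charge_above v l v' l' x : v \in V -> l \in S -> e v l ->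
    v' \in V -> l' \in S -> e v' l' -> charged v l x -> charged v' l' x ->
    l \notin below x -> l' \notin below x ->
  ~~ (index l (enum (S :\: below x)) < index l' (enum (S :\: below x))).
Proof.
move=> vV lS evl v'V l'S evl' [xV xr Hl] [_ _ Hl'] lb lb'.
rewrite (negPf lb) (negPf lb') in Hl Hl'.
have lS' : l' \in S :\: below x by rewrite inE l'S andbT.
have := index_lt lS'; move: Hl Hl'.
set i := index _ _; set i' := index _ _ => -[iE thi] [iE' thi'] ilt'.
apply/negP=> lt; have ine : l != l'.
  by apply/eqP=> E; move: lt; rewrite /i /i' E ltnn.
have lA := subsetP SA l lS; have l'A := subsetP SA l' l'S.
have vA := leaf_nbr_inner lA vV evl; have vA' := leaf_nbr_inner l'A v'V evl'.
have Ei : i' = ((i' - i.+1).+1 + i)%N by rewrite addSn -addnS subnK.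
have uE : iter (i' - i.+1).+1 p v' = v.
  apply: (@thread_inj i) => //; first exact: iter_mem.
    by apply: thread_iter; rewrite -Ei.
  by rewrite -iterD addnC -Ei iE' iE.
have th : thread v' (i' - i.+1) by apply: thread_le thi'; apply: leq_subr.
have := @leaf_nbrs_far v' (i' - i.+1) l l' v'V vA' th; rewrite uE.
move=> /(_ vA lA l'A ine evl evl') H; suff : lam <= i' - i.+1.
  by have := card_below x; move: ilt' lt; clearbody i i'; move: #|_| #|_|; clear; lia.
have bE : below v' = below x by rewrite -iE' below_thread.
apply: H; left; split.
  by move: lb'; rewrite -bE mem_below l'S.
right; rewrite -uE; apply: thi'; rewrite ltn0Sn /=.
by rewrite [X in _ <= X]Ei leq_addr.
Qed.

(** Otherwise v' would lie above x and v below or at x, on one thread, too close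
    together. *)
Lemma charge_cross v l v' l' x : v \in V -> l \in S -> e v l ->
    v' \in V -> l' \in S -> e v' l' -> charged v l x -> charged v' l' x ->
  l \notin below x -> l' \notin below x.
Proof.
move=> vV lS evl v'V l'S evl' [xV xr Hl] [_ _ Hl'] lb; apply/negP=> lb'.
rewrite (negPf lb) lb' in Hl Hl'.
have lS' : l \in S :\: below x by rewrite inE lS andbT.
have := index_lt lb'; have := index_lt lS'; move: Hl Hl'.
set i := index _ _; set i' := index _ _ => -[iE thi] [iE' thi'] ilt ilt'.
have ine : l != l' by apply: contraNneq lb => ->.
have lA := subsetP SA l lS; have l'A := subsetP SA l' l'S.
have vA := leaf_nbr_inner lA vV evl; have vA' := leaf_nbr_inner l'A v'V evl'.
have uE : iter (i + i').+1 p v = v' by rewrite addnC -addSn iterD iE.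
have th : thread v (i + i') by apply: thread_cat => //; rewrite iE.
have := @leaf_nbrs_far v (i + i') l' l vV vA th; rewrite uE eq_sym ine.
move=> /(_ vA' l'A lA isT evl' evl) H; suff : lam <= i + i'.
  by have := card_below x; move: ilt' ilt; clearbody i i'; move: #|_| #|_|; clear; lia.
have bE : below v = below x by rewrite -iE below_thread.
apply: H; left; split; first by move: lb; rewrite -bE mem_below lS.
by left; move: lb'; rewrite -bE mem_below => /andP[].
Qed.

Lemma charge_inj v l v' l' x : v \in V -> l \in S -> e v l ->
    v' \in V -> l' \in S -> e v' l' -> charged v l x -> charged v' l' x ->
  v = v' /\ l = l'.
Proof.
move=> vV lS evl v'V l'S evl' c c'; have [lb|lb] := boolP (l \in below x).
  have [lb'|lb'] := boolP (l' \in below x); last first.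
    by have := charge_cross v'V l'S evl' vV lS evl c' c lb'; rewrite lb.
  have E : l = l'.
    have inj := @index_enum_inj (below x) l l' lb lb'.
    apply: inj; apply/eqP; rewrite eqn_leq.
    rewrite [X in X && _]leqNgt [X in _ && X]leqNgt.
    rewrite (charge_below vV lS evl v'V l'S evl' c c' lb lb').
    by rewrite (charge_below v'V l'S evl' vV lS evl c' c lb' lb).
  by move: c c'; rewrite -E => -[_ _ +] [_ _]; rewrite lb => -[<- _] [<- _].
have lb' := charge_cross vV lS evl v'V l'S evl' c c' lb.
have E : l = l'.
  have inS := @index_enum_inj (S :\: below x) l l'.
  apply: inS; [exact/setDP|exact/setDP|apply/eqP; rewrite eqn_leq].
  rewrite [X in X && _]leqNgt [X in _ && X]leqNgt.
  rewrite (charge_above vV lS evl v'V l'S evl' c c' lb lb').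
  by rewrite (charge_above v'V l'S evl' vV lS evl c' c lb' lb).
move: c c'; rewrite -E => -[_ _ +] [_ _]; rewrite (negPf lb) => -[iE th] [iE' th'].
by split=> //; apply: (thread_inj vV v'V th th'); rewrite iE iE'.
Qed.

(** A branching vertex less than lam steps above the leaf l would contradict
    [prune_branch], and the root cannot be so close because the tree would then
    be a path with fewer than lam + 2 vertices. *)
Lemma leaf_thread l n : l \in A -> l != rho -> n < lam -> thread l n.
Proof.
move=> lA lr; elim: n => [_ []//|n IH lt]; have th := IH (ltnW lt).
have lV := leafV lA; apply: thread_add => //.
have nr : iter n p l != rho.
  by case: (n) th => [//|n'] /(_ n'.+1 (ltnSn _)) /andP[].
have [zr|zr] := eqVneq (iter n.+1 p l) rho.
  have := card_thread_root lV th nr zr (fun y yV => desc_leaf lA lr yV).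
  by move: card_V lt; move: #|_| => c; clear; lia.
have [//|k2] := inner_single (iter_mem _ lV) (kid_inner zr (iter_kid lV zr)).
by have := @prune_branch l n.+1 lA lr isT th k2; rewrite leqNgt lt.
Qed.

(** No leaf of S is below such a vertex x, so v would lie between x and j, too
    close to j by [prune_edge]. *)
Lemma charge_spare v l x j i : v \in V -> l \in S -> e v l -> charged v l x ->
  j \in A -> j \notin S -> i < lam -> x != iter i p j.
Proof.
move=> vV lS evl [xV xr H] jA jS lt; apply/eqP=> E.
have jr : j != rho by apply: contraNneq jS => ->.
have jV := leafV jA; have th := leaf_thread jA jr lt.
have b0 : below x = set0.
  rewrite E below_thread //; apply/setP=> s; rewrite mem_below inE.
  apply/negP=> /andP[sS /(desc_leaf jA jr (leafV (subsetP SA s sS))) sj].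
  by rewrite -sj sS in jS.
move: H; rewrite b0 inE => -[H _].
have vx : desc v (iter i p j) by rewrite -E -H fconnect_iter.
have [i' le vE] := thread_low jA jr vV th vx.
have lA := subsetP SA l lS.
have lj : l != j by apply: contraNneq jS => <-.
rewrite vE in evl; have := prune_edge jA jr (thread_le le th) lA lj evl.
by rewrite leqNgt (leq_ltn_trans le lt).
Qed.

Lemma degree_count :
  \sum_(l in S) degree e l + lam * (k.+1 - #|S|) + 1 <= #|V|.
Proof.
pose P := [set q : T * T | (q.1 \in S) && e q.1 q.2].
have -> : \sum_(l in S) degree e l = #|P|.
  rewrite -sum1_card (eq_bigl (fun q : T * T => (q.1 \in S) && e q.1 q.2)); last first.
    by move=> q; rewrite inE.
  rewrite -(pair_big_dep (mem S) (fun l v => e l v) (fun _ _ => 1)) /=.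
  by apply: eq_bigr => l _; rewrite /degree -sum1_card; apply: eq_bigl => v; rewrite inE.
have PP q : q \in P -> [/\ q.2 \in V, q.1 \in S & e q.2 q.1].
  rewrite inE => /andP[lS elv]; split=> //; last by rewrite e_sym.
  by apply: nbrA elv; apply: (subsetP SA).
have /boolp.choice[f fP] : forall q, exists x, q \in P -> charged q.2 q.1 x.
  move=> q; case: (boolP (q \in P)) => [/PP[v l elv]|_]; last by exists rho.
  by have [x c] := charge_exists v l elv; exists x.
have finj : {in P &, injective f}.
  move=> [l v] [l' v'] qP q'P E; have [vV lS elv] := PP _ qP.
  have [vV' lS' elv'] := PP _ q'P; have := fP _ q'P; rewrite -E.
  by case/(charge_inj vV lS elv vV' lS' elv' (fP _ qP)) => /= -> ->.
pose W := [set iter (val q.1) p q.2 | q in setX [set: 'I_lam] (A :\: S)].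
have jP j : j \in A :\: S -> [/\ j \in A, j \notin S & j != rho].
  case/setDP=> jA jS; split=> //; by apply: contraNneq jS => ->.
have cW : #|W| = lam * (k.+1 - #|S|).
  have -> : lam * (k.+1 - #|S|) = #|setX [set: 'I_lam] (A :\: S)|.
    by rewrite cardsX cardsT card_ord cardsD (setIidPr SA) card_A.
  apply: card_in_imset => -[i j] [i' j'] /setXP[_ /jP[jA jS jr]].
  move=> /setXP[_ /jP[jA' jS' jr']] /= E.
  have th := leaf_thread jA jr (ltn_ord i).
  have th' := leaf_thread jA' jr' (ltn_ord i').
  have key a b (aA : a \in A) (bA : b \in A) (ar : a != rho) (br : b != rho)
      (s t : nat) : s <= t -> thread a s -> thread b t ->
      iter s p a = iter t p b -> s = t /\ a = b.
    move=> st tha thb Eab; have thb' : thread (iter (t - s) p b) s.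
      by apply: thread_iter; rewrite subnK.
    have ab : a = iter (t - s) p b.
      apply: thread_inj (leafV aA) (iter_mem _ (leafV bA)) tha thb' _.
      by rewrite -iterD subnKC.
    have [ts0|ts0] := posnP (t - s); last first.
      have /single_inner : single a by rewrite ab; apply: thb; rewrite ts0 leq_subr.
      by rewrite aA.
    split; last by rewrite ab ts0.
    by apply/eqP; rewrite eqn_leq st -subn_eq0 ts0.
  have [le|/ltnW le] := leqP i i'.
    by have [/val_inj -> ->] := key _ _ jA jA' jr jr' _ _ le th th' E.
  by have [/val_inj -> ->] := key _ _ jA' jA jr' jr _ _ le th' th (esym E).
have fV : f @: P \subset V :\: (rho |: W).
  apply/subsetP=> _ /imsetP[q qP ->]; have [xV xr _] := fP q qP.
  have [vV lS elv] := PP q qP; rewrite !inE xV negb_or xr andbT /=.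
  apply/imsetP=> -[[i j] /setXP[_ /jP[jA jS _]]] /= E.
  by have := charge_spare vV lS elv (fP q qP) jA jS (ltn_ord i); rewrite E eqxx.
have WV : rho |: W \subset V.
  rewrite subUset sub1set rhoV; apply/subsetP=> _ /imsetP[[i j] /setXP[_ /jP[jA _ _]] ->].
  exact/iter_mem/leafV.
have rW : rho \notin W.
  apply/imsetP=> -[[i j] /setXP[_ /jP[jA _ jr]]] /= E.
  have := leaf_thread jA jr (ltn_ord i).
  case: (val i) E => [/= E|i' E] th; first by rewrite -E eqxx in jr.
  by have /andP[] := th i'.+1 (ltnSn _); rewrite -E eqxx.
have := subset_leq_card fV; rewrite (card_in_imset finj) cardsD (setIidPr WV).
rewrite cardsU1 rW cW; have := subset_leq_card WV; rewrite cardsU1 rW cW.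
by move: (lam * _) #|P| #|V|; clear; lia.
Qed.
End RootedTree.

(** * The degree sum of leaves of a largest tree *)

Section LargestTree.
Variable T : finType.
Implicit Types (e r : rel T) (V A S : {set T}) (x y : T).

Lemma ended_tree_order_attained e k x : 0 < k -> exists V r,
  [/\ subgraph V r e, ended_tree k V r & ended_tree_order e k = #|V|].
Proof.
move=> k0; have := ended_tree_order_gt0 e x k0; rewrite /ended_tree_order.
pose P (V : {set T}) := `[< exists2 r, subgraph V r e & ended_tree k V r >].
have [P0|] := posnP #|[pred V | P V]|.
  by rewrite big_pred0 // => V; have := card0_eq P0 V; rewrite inE.
move/(eq_bigmax_cond (fun V : {set T} => #|V|)) => [V]; rewrite inE.
by case/asboolP=> r sub et -> _; exists V, r.
Qed.

Lemma rooted_tree V r e rho : irreflexive e -> subgraph V r e -> tree V r ->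
    rho \in V -> exists p h,
  [/\ p rho = rho, forall x, x \in V -> p x \in V,
      forall x, x \in V -> x != rho -> h (p x) < h x,
      forall x, x \in V -> x != rho -> r x (p x) &
      forall x y, r x y -> (x != rho /\ p x = y) \/ (y != rho /\ p y = x)].
Proof.
move=> ei [rs sub] [[_ con] ac] rhoV.
have ri : irreflexive r by move=> x; apply/negP=> /sub[_ _]; rewrite ei.
have [p [h [pr pP]]] := exists_parent r rho; exists p, h.
have cr x : x \in V -> connect r x rho by move=> xV; apply: con.
split=> // [x xV|x xV xr|x xV xr|x y rxy].
- have [->|xr] := eqVneq x rho; first by rewrite pr.
  by have [/sub[]] := pP x (cr x xV) xr.
- by have [] := pP x (cr x xV) xr.
- by have [] := pP x (cr x xV) xr.
- by have [xV _ _] := sub _ _ rxy; apply: (acyclic_edge_parent rs ri ac pP (cr x xV) rxy).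
Qed.

Lemma connected_nbr V r x : {in V &, forall x y, connect r x y} ->
  x \in V -> 1 < #|V| -> exists y, r x y.
Proof.
move=> con xV; rewrite (cardsD1 x) xV => /card_gt0P[y /setD1P[yx yV]].
case/connectP: (con _ _ xV yV) => -[|z q] /=; first by move=> _ E; rewrite E eqxx in yx.
by case/andP=> rxz _ _; exists z.
Qed.

Lemma tree_spanning_ends V r e : irreflexive e -> subgraph V r e -> tree V r ->
  1 < #|V| -> exists2 F, spanning_ends e V F (leaves V r) & #|F| < #|V|.
Proof.
move=> ei sub tr V1; have [rho rhoV] : exists x, x \in V.
  by apply/set0Pn; rewrite -card_gt0 ltnW.
have [p [h [pr pV hp rp edge]]] := rooted_tree ei sub tr rhoV.
have [rs rsub] := sub; have [[_ con] _] := tr.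
exists [set (x, p x) | x in V :\ rho]; last first.
  by rewrite [X in _ < X](cardsD1 rho) rhoV ltnS leq_imset_card.
have adjr : adj [set (x, p x) | x in V :\ rho] =2 r.
  move=> x y; apply/idP/idP => [|rxy].
    case/orP=> /imsetP[z /setD1P[zr zV] [-> ->]]; first exact: rp.
    by rewrite rs; apply: rp.
  have [xV yV _] := rsub _ _ rxy; apply/orP.
  by case: (edge x y rxy) => -[nr <-]; [left|right]; apply: imset_f; apply/setD1P.
split.
- by move=> x y xy; apply: rsub; rewrite -adjr /adj xy.
- by move=> x y xV yV; rewrite (eq_connect adjr); apply: con.
- move=> x xV; rewrite inE xV /= => deg.
  have [y xy] := connected_nbr con xV V1.
  have : 1 < degree r x.
    rewrite ltn_neqAle eq_sym deg /= /degree; apply/card_gt0P.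
    by exists y; rewrite inE.
  case/card_gt1P=> a [b []]; rewrite !inE => ra rb ab.
  by exists a, b; rewrite !adjr.
Qed.

(** An edge is a path, and by convention also a cycle of order 2. *)
Lemma ended_tree_order_edge e k x y : symmetric e -> irreflexive e -> 0 < k ->
  e x y -> 2 <= ended_tree_order e k.
Proof.
move=> es ei k0 exy; have xy : x != y by apply: contraTneq exy => ->; rewrite ei.
have [->|k1] := eqVneq k 1; first exact: ended_tree_order1_edge exy.
have cV : #|[set x; y]| = 2 by rewrite cards2 xy.
rewrite -[X in X <= _]cV.
apply: (@order_ge_spanning_ends _ e k _ [set (x, y)] [set x; y]) => //.
- by apply/set0Pn; exists x; rewrite !inE eqxx.
- split.
  + by move=> a b; rewrite inE => /eqP[-> ->]; rewrite !inE !eqxx orbT.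
  + have cxy : connect (adj [set (x, y)]) x y.
      by apply: connect1; rewrite adj_edge !eqxx.
    move=> a b /set2P[]-> /set2P[]-> //.
    by rewrite (sym_connect_sym (adj_sym _)).
  + by move=> a ->.
- by rewrite cV cards1 addn1; case: (k) k0 k1 => [|[]].
Qed.

Lemma rooted_leaves V r e rho p (h : T -> nat) : subgraph V r e ->
    p rho = rho -> (forall x, x \in V -> x != rho -> h (p x) < h x) ->
    (forall x, x \in V -> x != rho -> r x (p x)) ->
    (forall x y, r x y -> (x != rho /\ p x = y) \/ (y != rho /\ p y = x)) ->
    rho \in leaves V r ->
  #|kids V rho p rho| = 1 /\
  forall x, (x \in leaves V r) =
            (x \in V) && ((x == rho) || (kids V rho p x == set0)).
Proof.
move=> [rs rsub] pr hp rp edge rl.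
have rhoV : rho \in V by move: rl; rewrite inE => /andP[].
have kr x y : y \in kids V rho p x -> r x y.
  by rewrite inE => /and3P[yV yr /eqP <-]; rewrite rs; apply: rp.
have rk x y : r x y -> y != p x \/ x = rho -> y \in kids V rho p x.
  move=> rxy ne; have [xV yV _] := rsub _ _ rxy; rewrite inE yV /=.
  case: (edge x y rxy) => -[nr E]; last by rewrite nr E eqxx.
  by case: ne => [|E']; [rewrite E eqxx|rewrite E' eqxx in nr].
split.
  move: rl; rewrite inE rhoV /= => /eqP <-; rewrite /degree; congr #|pred_of_set _|.
  by apply/setP=> y; rewrite [RHS]inE; apply/idP/idP=> [/kr //|ry]; apply: rk; last by right.
move=> x; rewrite inE; have [xV|//] := boolP (x \in V).
have [->|xr] := eqVneq x rho; first by move: rl; rewrite inE rhoV.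
rewrite /= /degree (_ : [set y | r x y] = p x |: kids V rho p x); last first.
  apply/setP=> y; rewrite !in_setU1 [LHS]inE; apply/idP/orP=> [rxy|[/eqP->|/kr//]].
    by have [|ne] := eqVneq y (p x); [left|right; apply: rk rxy _; left].
  exact: rp.
rewrite cardsU1; suff -> : p x \notin kids V rho p x.
  by rewrite add1n eqSS cards_eq0.
rewrite inE; apply/negP=> /and3P[pV pxr /eqP E].
have := ltn_trans (hp _ pV pxr) (hp _ xV xr); by rewrite E ltnn.
Qed.

(** Otherwise v could be attached to the leaf l: it would replace l as an end,
    and the tree would not be a largest one. *)
Lemma leaf_nbr_mem V r e k l v : symmetric e -> irreflexive e -> subgraph V r e ->
    tree V r -> 1 < #|V| -> #|leaves V r| <= k.+1 ->
    ended_tree_order e k.+1 <= #|V| ->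
  l \in leaves V r -> e l v -> v \in V.
Proof.
move=> es ei sub tr V1 lek leV lA elv; apply: contraT => vV.
have [F [wf con two] ltF] := tree_spanning_ends ei sub tr V1.
have lV : l \in V by move: lA; rewrite inE => /andP[].
have cV : #|v |: V| = #|V|.+1 by rewrite cardsU1 vV.
set A := leaves V r in lek lA two.
pose F' := (v, l) |: F; pose A' := v |: (A :\ l).
have sF := sym_connect_sym (adj_sym F').
have mono x y : adj F x y -> adj F' x y.
  by case/orP=> xy; apply/orP; [left|right]; rewrite inE xy orbT.
have vl : adj F' v l by rewrite /adj !inE eqxx.
have con1 x : x \in v |: V -> connect (adj F') x l.
  case/setU1P=> [->|xV]; first exact: connect1.
  by apply: connect_sub (con _ _ xV lV) => a b /mono/connect1.
suff : #|v |: V| <= ended_tree_order e k.+1.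
  by rewrite cV => /leq_trans/(_ leV); rewrite ltnn.
apply: (@order_ge_spanning_ends _ e k.+1 _ F' A') => //.
- by apply/set0Pn; exists v; rewrite setU11.
- split.
  + move=> x y /setU1P[[-> ->]|/wf[xV yV exy]].
      by rewrite setU11 inE lV orbT es.
    by rewrite !inE xV yV !orbT.
  + by move=> x y xV yV; apply: connect_trans (con1 x xV) _; rewrite sF con1.
  + move=> x /setU1P[->|xV]; first by rewrite setU11.
    rewrite !in_setU1 in_setD1 negb_or negb_and negbK => /andP[xv /orP[/eqP->|xA]].
      have [y ly] := connected_nbr con lV V1.
      exists y, v; rewrite mono // adj_sym vl; split=> //.
      by apply: contraNneq vV => <-; case/orP: ly => /wf[].
    have [y [z [yz xy xz]]] := two x xV xA.
    by exists y, z; split=> //; apply: mono.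
- have : #|A'| <= (#|A :\ l|).+1 by rewrite /A' cardsU1; case: (_ \notin _).
  have : #|F'| <= #|F|.+1 by rewrite /F' cardsU1; case: (_ \notin _).
  have := cardsD1 l A; rewrite lA cV; move: lek ltF.
  by move: #|A'| #|F'| #|F| #|V| #|A :\ l| #|A|; clear; lia.
Qed.

Lemma exists_subset_card A m :
  m <= #|A| -> exists2 S : {set T}, S \subset A & #|S| = m.
Proof.
move=> le; exists [set x in take m (enum A)].
  by apply/subsetP=> x; rewrite inE => /mem_take; rewrite mem_enum.
rewrite cardsE (card_uniqP _) ?take_uniq ?enum_uniq // size_takel //.
by rewrite -cardE.
Qed.

(** The set S consists of leaves of a largest (k+1)-ended tree. This tree has
    exactly k+1 leaves, as otherwise it would be k-ended. *)
Lemma leaves_degree_sum e k lam m (x0 : T) :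
    symmetric e -> irreflexive e -> 0 < k -> 0 < lam -> 0 < m ->
    m <= k.+1 -> m <= lam.+1 ->
    ended_tree_order e k + lam <= ended_tree_order e k.+1 ->
  exists S, [/\ independent e S, #|S| = m &
    \sum_(l in S) degree e l + lam * (k.+1 - m) + 1 <= ended_tree_order e k.+1].
Proof.
move=> es ei k0 lam0 m0 mk mlam short.
have [V [r [sub et tV]]] := ended_tree_order_attained e x0 (ltn0Sn k).
have t0 := ended_tree_order_gt0 e x0 k0.
have [tr lek] : tree V r /\ #|leaves V r| <= k.+1.
  by move: et; rewrite /ended_tree eqSS (negPf (lt0n_neq0 k0)).
have V1 : 1 < #|V| by rewrite -tV; apply: leq_trans short; rewrite -[2]/(1 + 1) leq_add.
have [F sp ltF] := tree_spanning_ends ei sub tr V1.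
have V0 : V != set0 by rewrite -card_gt0 ltnW.
have cA : #|leaves V r| = k.+1.
  apply/eqP; rewrite eqn_leq lek ltnNge; apply/negP=> le.
  have : #|V| <= ended_tree_order e k.
    apply: (order_ge_spanning_ends es ei k0 V0 sp).
    by move: le ltF; move: #|leaves _ _| #|F| #|V|; clear; lia.
  rewrite -tV; move: short lam0; move: (ended_tree_order _ _) (ended_tree_order _ _).
  by clear; lia.
have V3 : lam.+2 <= #|V|.
  have [x xV] := set0Pn _ V0; have [[_ con] _] := tr.
  have [y rxy] := connected_nbr con xV V1; have [_ _ exy] := sub.2 _ _ rxy.
  rewrite -tV; apply: leq_trans short; rewrite addnC -addn2 leq_add2l.
  exact: ended_tree_order_edge exy.
have [S SA cS] : exists2 S : {set T}, S \subset leaves V r & #|S| = m.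
  by apply: exists_subset_card; rewrite cA.
have [rho rhoS] : exists x, x \in S by apply/set0Pn; rewrite -card_gt0 cS.
have rl := subsetP SA rho rhoS.
have rhoV : rho \in V by move: rl; rewrite inE => /andP[].
have [p [h [pr pV hp rp edge]]] := rooted_tree ei sub tr rhoV.
have [krho leafE] := rooted_leaves sub pr hp rp edge rl.
have ep x : x \in V -> x != rho -> e x (p x).
  by move=> xV xr; have [] := sub.2 _ _ (rp x xV xr).
have order_gap (V' : {set T}) F' (A' : {set T}) : V' != set0 -> spanning_ends e V' F' A' ->
    #|A'| + #|F'| + 1 <= #|V'| + k -> #|V'| + lam <= #|V|.
  move=> V'0 sp' le; rewrite -tV; apply: leq_trans short.
  by rewrite leq_add2r; apply: (order_ge_spanning_ends es ei k0 V'0 sp').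
have leV : ended_tree_order e k.+1 <= #|V| by rewrite tV.
have nbrA l v : l \in leaves V r -> e l v -> v \in V.
  exact: (leaf_nbr_mem es ei sub tr V1 lek leV).
exists S; split=> //.
  apply/forall_inP=> x xS; apply/forall_inP=> y yS.
  have xA := subsetP SA x xS; have yA := subsetP SA y yS.
  apply/negP=> exy; have xV : x \in V by move: xA; rewrite inE => /andP[].
  by have := leaf_nbr_inner rhoV pr pV hp krho es ei ep leafE cA order_gap lam0 V3 yA xV exy; rewrite xA.
have cSl : #|S| <= lam.+1 by rewrite cS.
rewrite tV -cS.
exact: (degree_count rhoV pr pV hp krho es ei ep leafE cA order_gap lam0 V3 SA rhoS cSl nbrA).
Qed.

End LargestTree.

Import Order.TTheory GRing.Theory Num.Theory.
Local Open Scope ring_scope.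

Theorem theorem3 (T : finType) (e : rel T)
  (e_sym : symmetric e) (e_irr : irreflexive e)
  (e_conn : connected_graph [set: T] e)
  (k lambda m : nat)
  (k_gt0 : (0 < k)%N) (lambda_gt0 : (0 < lambda)%N) (m_gt0 : (0 < m)%N)
  (m_le : (m <= minn k lambda + 1)%N)
  (sigma_ge :
    (((ended_tree_order e k.+1)%:Z - lambda%:Z * (k%:Z - m%:Z + 1))%:E
       <= degree_sum e m)%E) :
  (ended_tree_order e k)%:Z >= (ended_tree_order e k.+1)%:Z - lambda%:Z + 1.
Proof.
have [x0 _] := set0Pn _ e_conn.1.
rewrite leNgt; apply/negP=> lt.
have short : (ended_tree_order e k + lambda <= ended_tree_order e k.+1)%N.
  by move: lt; move: (ended_tree_order _ _) (ended_tree_order _ _); clear; lia.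
have mk : (m <= k.+1)%N by move: m_le; clear; lia.
have ml : (m <= lambda.+1)%N by move: m_le; clear; lia.
have [S [indS cS sumS]] :=
  leaves_degree_sum x0 e_sym e_irr k_gt0 lambda_gt0 m_gt0 mk ml short.
move: sigma_ge; rewrite /degree_sum ifT; last first.
  by rewrite -cS /independence_number; apply: (@leq_bigmax_cond _ _ (fun S : {set T} => #|S|)).
apply/negP; rewrite -ltNge.
apply: (@le_lt_trans _ _ ((\sum_(x in S) degree e x)%N%:Z)%:E%E).
  apply: (@bigmin_le_cond _ _ _ _ S (fun S => independent e S && (#|S| == m))
           (fun S => ((\sum_(x in S) degree e x)%N%:Z)%:E%E)).
  by rewrite indS cS eqxx.
rewrite lte_fin; move: sumS mk.
move: (\sum_(_ in _) _)%N (ended_tree_order _ _) => s t; clear.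
move=> h1 h2; nia.
Qed.
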